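(* Let $\Gamma=(\Gamma_j)_{j\ge1}$ and $\Gamma'=(\Gamma'_j)_{j\ge1}$ be nested sequences of lattices in $H_3(\mathbb R)$, $\Gamma_1\supset\Gamma_2\supset\cdots$ and $\Gamma'_1\supset\Gamma'_2\supset\cdots$, and let $T$, $T'$ be the $H_3(\mathbb R)$-odometers associated with $\Gamma$ and $\Gamma'$. Then $T$ and $T'$ are f-isomorphic if and only if $S_\Gamma=S_{\Gamma'}$ and $\xi_\Gamma=\xi_{\Gamma'}$.
   Context: $H_3(\mathbb R)$: real $3\times3$ upper triangular unipotent matrices; $c(t)$ denotes the matrix with $(1,3)$ entry $t$ and other off-diagonal entries $0$; for $g$ with $(1,2)$ entry $t_1$ and $(2,3)$ entry $t_2$, $p(g)=(t_1,t_2)$. A lattice is a discrete subgroup of finite covolume. For a lattice $\Lambda$: $\Lambda\cap\{c(t)\}=\{c(m\xi_\Lambda):m\in\mathbb Z\}$ with $\xi_\Lambda>0$; $p(\Lambda)=A\mathbb Z^2$ with $A\in GL_2(\mathbb R)$ and $p(\Lambda)^*:=(A^* )^{-1}\mathbb Z^2$. For a nested sequence $\Gamma$, $S_\Gamma:=\bigcup_j p(\Gamma_j)^*\subset\mathbb R^2$ and $\xi_\Gamma:=\bigcup_j\xi_{\Gamma_j}^{-1}\mathbb Z\subset\mathbb R$. The $H_3(\mathbb R)$-odometer associated with a nested sequence of lattices is the left-translation action on $\varprojlim H_3(\mathbb R)/\Gamma_j$ with the inverse limit of invariant probability measures. Two $H_3(\mathbb R)$-odometers are f-isomorphic if they are associated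 with some nested sequences $(\Lambda_j)$, $(\Lambda'_j)$ of lattices such that $\Lambda_j$ and $\Lambda'_j$ are conjugate in $H_3(\mathbb R)$ for each $j$. *)

(* Defs.v *)
From mathcomp Require Import all_boot all_algebra.
From mathcomp Require Import all_classical all_reals all_analysis.
From mathcomp Require Import ring.

Set Implicit Arguments.
Unset Strict Implicit.
Unset Printing Implicit Defensive.

Import GRing.Theory Num.Theory.
Local Open Scope classical_set_scope.
Local Open Scope ring_scope.

Section Heisenberg.
Variable R : realType.

(** * The Heisenberg group H_3(R)
    An element ((t1, t2), t3) represents the upper unitriangular matrix
        [[1, t1, t3], [0, 1, t2], [0, 0, 1]]
    i.e. t1 = (1,2) entry, t2 = (2,3) entry, t3 = (1,3) entry.  The group law
    below is the matrix product written out in these coordinates. *)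
Definition H3 := (R * R * R)%type.

Definition hmul (g h : H3) : H3 :=
  (g.1.1 + h.1.1, g.1.2 + h.1.2, g.2 + h.2 + g.1.1 * h.1.2).
Definition hone : H3 := (0, 0, 0).
Definition hinv (g : H3) : H3 := (- g.1.1, - g.1.2, g.1.1 * g.1.2 - g.2).

Definition cen (t : R) : H3 := (0, 0, t).

Definition pr (g : H3) : 'cV[R]_2 := \col_(i < 2) [:: g.1.1; g.1.2]`_i.

(** Haar measure of H_3(R): Lebesgue measure in the coordinates (t1,t2,t3)
    (left and right translations have Jacobian 1). *)
Definition haar := ((@lebesgue_measure R \x @lebesgue_measure R)
                      \x @lebesgue_measure R)%E.

Definition subgroup (G : set H3) : Prop :=
  [/\ G hone, (forall a b, G a -> G b -> G (hmul a b)) &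
      (forall a, G a -> G (hinv a))].

Definition discrete_subgroup (G : set H3) : Prop :=
  subgroup G /\
  exists2 e : R, 0 < e & forall g, G g ->
    `|g.1.1| < e -> `|g.1.2| < e -> `|g.2| < e -> g = hone.

Definition fundamental_domain (G : set H3) (F : set H3) : Prop :=
  [/\ measurable F,
      (forall g, exists f gam, [/\ F f, G gam & g = hmul f gam]) &
      (forall f1 f2 gam1 gam2, F f1 -> F f2 -> G gam1 -> G gam2 ->
          hmul f1 gam1 = hmul f2 gam2 -> f1 = f2)].

Definition lattice (G : set H3) : Prop :=
  discrete_subgroup G /\
  exists2 F, fundamental_domain G F & (haar F < +oo)%E.

(** nested sequence of lattices  Gamma_0 ⊇ Gamma_1 ⊇ ...  (indices shifted by 1) *)
Definition nested_lattices (G : nat -> set H3) : Prop :=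
  (forall j, lattice (G j)) /\ (forall j, G j.+1 `<=` G j).

Definition conjugate (L L' : set H3) : Prop :=
  exists g, L' = [set hmul (hmul g gam) (hinv g) | gam in L].

Definition intcv (n : 'cV[int]_2) : 'cV[R]_2 := map_mx (fun z : int => z%:~R) n.

Definition dual_proj (L : set H3) : set 'cV[R]_2 :=
  fun v => exists A : 'M[R]_2,
    [/\ A \in unitmx,
        pr @` L = [set A *m intcv n | n in [set: 'cV[int]_2]] &
        exists n : 'cV[int]_2, v = invmx (A^T) *m intcv n].

Definition S_of (G : nat -> set H3) : set 'cV[R]_2 :=
  \bigcup_j dual_proj (G j).

Definition is_xi (L : set H3) (xi : R) : Prop :=
  0 < xi /\ forall t, L (cen t) <-> exists m : int, t = m%:~R * xi.

Definition xi_of (G : nat -> set H3) : set R :=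
  fun t => exists j xi, is_xi (G j) xi /\ exists m : int, t = m%:~R / xi.

Definition lcoset (L : set H3) (g : H3) : set H3 := [set hmul g gam | gam in L].

Definition inv_lim (G : nat -> set H3) (x : nat -> set H3) : Prop :=
  (forall j, exists g, x j = lcoset (G j) g) /\ (forall j, x j.+1 `<=` x j).

Definition odo (G : nat -> set H3) := {x : nat -> set H3 | inv_lim G x}.

Lemma hmulA (a b c : H3) : hmul a (hmul b c) = hmul (hmul a b) c.
Proof.
case: a => [[a1 a2] a3]; case: b => [[b1 b2] b3]; case: c => [[c1 c2] c3].
rewrite /hmul /=; congr (_, _, _); ring.
Qed.

Lemma inv_lim_act (G : nat -> set H3) (h : H3) (x : nat -> set H3) :
  inv_lim G x -> inv_lim G (fun j => hmul h @` x j).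
Proof.
case=> Hc Hn; split.
- move=> j; have [g ->] := Hc j; exists (hmul h g).
  rewrite /lcoset; apply/seteqP; split => y /=.
  + by case=> _ [gam Lg <-] <-; exists gam => //; rewrite hmulA.
  + by case=> gam Lg <-; exists (hmul g gam); [exists gam|rewrite hmulA].
- by move=> j y [z zx <-]; exists z => //; exact: Hn.
Qed.

Definition odo_act (G : nat -> set H3) (h : H3) (x : odo G) : odo G :=
  exist _ (fun j => hmul h @` proj1_sig x j) (inv_lim_act h (proj2_sig x)).

(** Borel sets of H_3(R)/Gamma_j, identified with right-Gamma_j-invariant
    Borel subsets of H_3(R) (quotient Borel structure) *)
Definition quot_borel (L : set H3) (U : set H3) : Prop :=
  measurable U /\ (forall g gam, U g -> L gam -> U (hmul g gam)).

(** cylinder  pi_j^{-1}(U/Gamma_j) *)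
Definition cyl (G : nat -> set H3) (j : nat) (U : set H3) : set (odo G) :=
  [set x | proj1_sig x j `<=` U].

Definition odo_meas (G : nat -> set H3) : set (set (odo G)) :=
  <<s (fun A : set (odo G) =>
        exists j U, quot_borel (G j) U /\ A = @cyl G j U) >>.

(** mu is the inverse limit of the invariant probability measures m_j on
    H_3(R)/Gamma_j: mu is a (countably additive) measure on odo_meas whose
    push-forward to each level j is m_j, where
      m_j(U/Gamma_j) = haar(U ∩ F) / haar(F)
    for any finite-measure fundamental domain F of Gamma_j. *)
Definition odo_measure (G : nat -> set H3) (mu : set (odo G) -> \bar R) : Prop :=
  [/\ mu set0 = 0%E,
      (forall A, @odo_meas G A -> (0 <= mu A)%E),
      (forall F : (set (odo G))^nat, (forall n, @odo_meas G (F n)) ->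
          trivIset setT F -> mu (\bigcup_n F n) = (\sum_(n <oo) mu (F n))%E) &
      (forall j U F, quot_borel (G j) U -> fundamental_domain (G j) F ->
          (haar F < +oo)%E -> (mu (@cyl G j U) * haar F = haar (U `&` F))%E)].

Definition odo_isomorphism (G G' : nat -> set H3)
    (mu : set (odo G) -> \bar R) (mu' : set (odo G') -> \bar R)
    (phi : odo G -> odo G') (psi : odo G' -> odo G) : Prop :=
  [/\ (forall B, @odo_meas G' B -> @odo_meas G (phi @^-1` B)),
      (forall A, @odo_meas G A -> @odo_meas G' (psi @^-1` A)),
      (forall B, @odo_meas G' B -> mu (phi @^-1` B) = mu' B) &
    [/\ (exists2 N, @odo_meas G N /\ mu N = 0%E &
          forall x, ~ N x -> psi (phi x) = x),
      (exists2 N', @odo_meas G' N' /\ mu' N' = 0%E &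
          forall y, ~ N' y -> phi (psi y) = y) &
      (forall h, exists2 N, @odo_meas G N /\ mu N = 0%E &
          forall x, ~ N x -> phi (odo_act h x) = odo_act h (phi x))]].

Definition odo_iso (G G' : nat -> set H3) : Prop :=
  exists mu mu', [/\ @odo_measure G mu, @odo_measure G' mu' &
    exists phi psi, odo_isomorphism mu mu' phi psi].

Definition f_isomorphic (G G' : nat -> set H3) : Prop :=
  exists L L', [/\ nested_lattices L, nested_lattices L',
    (forall j, conjugate (L j) (L' j)), odo_iso G L & odo_iso G' L'].

End Heisenberg.

(* Main.v *)
(** For a lattice L with p(L) = A Z^2 and centre xi Z, the commutator of g and h
    in L is the central element det(p(g), p(h)), so this determinant lies in
    xi Z; this forces discreteness of p(L). Two lattices with the same
    projection and the same centre are conjugate.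

    Sufficiency: equality of the invariants says that the projections and the
    centres of G and G' are mutually cofinal, so one interleaves levels n_j, m_j
    and takes L_j = G_(n_(j+1)) . cen(G'_(m_j)) and
    L'_j = {g in G'_(m_j) | p(g) in p(G_(n_(j+1)))}, which have the same projection
    and the same centre. Cofinal sequences have isomorphic odometers.

    Necessity: let phi : odo G -> odo L be a factor map and kappa a circle-valued
    function on H_3/L_j that a translation by h rotates by theta(h). The preimage
    of {kappa < 1/3} is approximated by a cylinder over some U in H_3/G_k. If h
    rotates by an angle between 1/3 and 2/3, then hU is far from U. For kappa the
    central coordinate, h in the centre of G_k fixes U, hence theta(h) = 0. For
    kappa a character of p, U is nearly invariant under the centre, and for h in
    G_k the translates of U by c(t)h are on average over t as close to U as its
    translates by c(t), hence again theta(h) = 0. *)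

From HB Require Import structures.
Require Import Defs.
From mathcomp Require Import all_boot all_order all_algebra.
From mathcomp Require Import all_classical all_reals all_analysis.
From mathcomp Require Import measurable_realfun ring lra zify.

Set Implicit Arguments.
Unset Strict Implicit.
Unset Printing Implicit Defensive.

Import Order.TTheory GRing.Theory Num.Theory.
Local Open Scope classical_set_scope.
Local Open Scope ring_scope.

(* The sets [U] are invariant under right multiplication by [G k], whereas the action is on the
   left. For a central element this makes no difference. For a general [w] in [G k] one has
   [w ** g = cen (hdet w g) ** g ** w], so left translation by [w] displaces [U] near [g] by a
   central amount that depends on [g]; this is the obstacle that the average over a period of the
   centre removes. Only measures of sets are compared: the arc {kappa < 1/3} has measure at least
   1/3, because three of its rotations cover the circle, and an approximation error of 1/24 on
   either side still separates 1/4 (sets moved off themselves) from 1/12 (sets nearly fixed). A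
   nonintegral angle outside the middle third is treated by passing to a multiple. In the other
   direction, an isomorphism asserts that inverse-limit measures exist, so one has to be
   constructed; and a lattice comes only with a fundamental domain of finite measure, from which
   noncollinear projections, finite index and a basis are extracted. *)
Local Infix "**" := (@hmul _) (at level 40, left associativity).

(** * Lattices of the Heisenberg group *)

Section Structure.
Variable R : realType.
Implicit Types (g h a b : H3 R) (L : set (H3 R)).

Lemma mul1h g : hone R ** g = g.
Proof. by case: g => [[x y] z]; rewrite /hmul /=; congr (_, _, _); ring. Qed.

Lemma mulh1 g : g ** hone R = g.
Proof. by case: g => [[x y] z]; rewrite /hmul /=; congr (_, _, _); ring. Qed.

Lemma mulhV g : g ** hinv g = hone R.
Proof.
by case: g => [[x y] z]; rewrite /hmul /hinv /hone /=; congr (_, _, _); ring.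
Qed.

Lemma mulVh g : hinv g ** g = hone R.
Proof.
by case: g => [[x y] z]; rewrite /hmul /hinv /hone /=; congr (_, _, _); ring.
Qed.

Lemma mulhK g h : g ** h ** hinv h = g.
Proof. by rewrite -hmulA mulhV mulh1. Qed.

Lemma mulhVK g h : g ** hinv h ** h = g.
Proof. by rewrite -hmulA mulVh mulh1. Qed.

Lemma mulKh g h : hinv g ** (g ** h) = h.
Proof. by rewrite hmulA mulVh mul1h. Qed.

Lemma mulVKh g h : g ** (hinv g ** h) = h.
Proof. by rewrite hmulA mulhV mul1h. Qed.

Lemma hinvM g h : hinv (g ** h) = hinv h ** hinv g.
Proof.
case: g => [[x y] z]; case: h => [[x' y'] z'].
by rewrite /hmul /hinv /=; congr (_, _, _); ring.
Qed.

Lemma hinvK g : hinv (hinv g) = g.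
Proof. by case: g => [[x y] z]; rewrite /hinv /=; congr (_, _, _); ring. Qed.

Lemma hinv1 : hinv (hone R) = hone R.
Proof. by rewrite /hinv /hone /=; congr (_, _, _); ring. Qed.

Lemma cenD (s t : R) : cen (s + t) = cen s ** cen t.
Proof. by rewrite /cen /hmul /=; congr (_, _, _); ring. Qed.

Lemma cenN (t : R) : cen (- t) = hinv (cen t).
Proof. by rewrite /cen /hinv /=; congr (_, _, _); ring. Qed.

Lemma cenC t g : cen t ** g = g ** cen t.
Proof.
by case: g => [[x y] z]; rewrite /hmul /cen /=; congr (_, _, _); ring.
Qed.

Definition hdet g h : R := g.1.1 * h.1.2 - g.1.2 * h.1.1.

Lemma commE g h : g ** h = cen (hdet g h) ** (h ** g).
Proof.
case: g => [[x y] z]; case: h => [[x' y'] z'].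
by rewrite /hmul /hdet /cen /=; congr (_, _, _); ring.
Qed.

Lemma intz_succ (n : nat) : (Posz n.+1)%:~R = n%:~R + 1 :> R.
Proof. by rewrite -!pmulrn -natr1. Qed.

Section Subgroup.
Variables (L : set (H3 R)) (sL : subgroup L).

Lemma subg1 : L (hone R). Proof. by case: sL. Qed.
Lemma subgM g h : L g -> L h -> L (g ** h).
Proof. by case: sL => _ + _; exact. Qed.
Lemma subgV g : L g -> L (hinv g).
Proof. by case: sL => _ _; exact. Qed.

Lemma subg_cen0 : L (cen 0). Proof. exact: subg1. Qed.

Lemma subg_comm g h : L g -> L h -> L (cen (hdet g h)).
Proof.
move=> Lg Lh; have := commE g h => /(congr1 (fun x => x ** hinv (h ** g))).
by rewrite mulhK => <-; do !apply: subgM => //; apply/subgV/subgM.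
Qed.

Lemma subg_mulz g (m : int) : L g ->
  exists2 w, L w & w.1.1 = m%:~R * g.1.1 /\ w.1.2 = m%:~R * g.1.2.
Proof.
move=> Lg; elim: m => [|n [w Lw [e1 e2]]|n [w Lw [e1 e2]]].
- by exists (hone R); [exact: subg1|rewrite !mul0r].
- exists (w ** g); first exact: subgM.
  by rewrite /= e1 e2 intz_succ; split; ring.
- exists (w ** hinv g); first by apply: subgM => //; exact: subgV.
  by move: e1 e2; rewrite /= !intrN intz_succ => -> ->; split; ring.
Qed.

End Subgroup.

(** A least positive element is found by minimizing the integer [truncn (s / e)]: two elements in
    the same cell of length [e] coincide by the gap hypothesis. Division with remainder by this
    element does the rest. *)
Lemma cyclic_subgroup_real (S : set R) (e : R) : 0 < e ->
  (forall s t, S s -> S t -> S (s - t)) ->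
  (forall s, S s -> `|s| < e -> s = 0) -> (exists2 s, S s & s != 0) ->
  exists2 xi, 0 < xi & forall t, S t <-> t / xi \is a Num.int.
Proof.
move=> e0 SB gap [s0 Ss0 s0N0].
have S0 : S 0 by rewrite -(subrr s0); exact: SB.
have SN s : S s -> S (- s) by move=> Ss; rewrite -sub0r; exact: SB.
have SD s t : S s -> S t -> S (s + t).
  by move=> Ss St; rewrite -(opprK t); apply: SB => //; exact: SN.
have Smul s (m : int) : S s -> S (m%:~R * s).
  move=> Ss; elim: m => [|n IH|n IH]; first by rewrite mul0r.
  - by rewrite intz_succ mulrDl mul1r; exact: SD.
  - by move: IH; rewrite !intrN intz_succ opprD mulrDl mulN1r => IH; exact: SB.
pose P := fun n : nat => `[< exists s, [/\ S s, 0 < s & Num.truncn (s / e) = n] >].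
have exP : exists n, P n.
  have [s0p|s0n|s00] := ltgtP 0 s0; last by rewrite -s00 eqxx in s0N0.
  - by exists (Num.truncn (s0 / e)); apply/asboolP; exists s0.
  - exists (Num.truncn (- s0 / e)); apply/asboolP; exists (- s0).
    by rewrite oppr_gt0; split => //; exact: SN.
case: (ex_minnP exP) => n /asboolP[xi [Sxi xi0 xin]] nmin.
have xi_min s : S s -> 0 < s -> xi <= s.
  move=> Ss sp; rewrite leNgt; apply/negP => sxi.
  have : (n <= Num.truncn (s / e))%N by apply: nmin; apply/asboolP; exists s.
  rewrite -xin => le1.
  have le2 : (Num.truncn (s / e) <= Num.truncn (xi / e))%N.
    by apply: le_truncn; rewrite ler_pM2r ?invr_gt0// ltW.
  have eqt : Num.truncn (s / e) = Num.truncn (xi / e).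
    by apply/eqP; rewrite eqn_leq le1 le2.
  have : xi - s = 0.
    apply: gap; first exact: SB.
    have /andP[a1 a2] := truncn_itv (divr_ge0 (ltW sp) (ltW e0)).
    have /andP[b1 b2] := truncn_itv (divr_ge0 (ltW xi0) (ltW e0)).
    rewrite ger0_norm ?subr_ge0 ?ltW//.
    have : (xi - s) / e < 1.
      rewrite mulrBl; move: a1 b2; rewrite eqt -addn1 natrD; lra.
    by rewrite ltr_pdivrMr// mul1r.
  lra.
exists xi => // t; split => [St|/intrP[m tm]]; last first.
  by rewrite -(divfK (lt0r_neq0 xi0) t) tm; exact: Smul.
pose m := Num.floor (t / xi).
have St' : S (t - m%:~R * xi) by apply: SB => //; exact: Smul.
have /andP[f1 f2] := floor_itv (t / xi).
have r0 : 0 <= t - m%:~R * xi by rewrite subr_ge0 -ler_pdivlMr.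
have r1 : t - m%:~R * xi < xi.
  by move: f2; rewrite ltr_pdivrMr// intrD mulrDl mul1r -/m; lra.
move: r0; rewrite le_eqVlt => /orP[/eqP r0|r0].
  have -> : t = m%:~R * xi by lra.
  by rewrite mulfK ?lt0r_neq0// intr_int.
by have := xi_min _ St' r0; rewrite leNgt r1.
Qed.

(* The elements a and b project to a basis of p(L) : Cramer's coordinates of
   p(g) in the basis (p(a), p(b)) are the two quotients of determinants. *)
Definition lattice_basis L a b (xi : R) : Prop :=
  [/\ L a /\ L b, hdet a b != 0,
      forall g, L g -> hdet g b / hdet a b \is a Num.int /\
                       hdet a g / hdet a b \is a Num.int,
      0 < xi & forall t, L (cen t) <-> t / xi \is a Num.int].

Lemma cramer a b g : hdet a b != 0 ->
  g.1.1 = hdet g b / hdet a b * a.1.1 + hdet a g / hdet a b * b.1.1 /\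
  g.1.2 = hdet g b / hdet a b * a.1.2 + hdet a g / hdet a b * b.1.2.
Proof. by rewrite /hdet => d0; split; field. Qed.

(** The commutator of [u] and [v] makes the central part nontrivial, hence cyclic; all determinants
    then lie in [xi] Z, which supplies the gap for two more cyclic groups. [b] realizes the least
    positive determinant with [u], and [a] generates the projections on the line through [p(u)];
    subtracting a multiple of [b] brings any [g] to that line. *)
Lemma discrete_lattice_basis L : discrete_subgroup L ->
  (exists u v, [/\ L u, L v & hdet u v != 0]) ->
  exists a b xi, lattice_basis L a b xi.
Proof.
move=> [sL [e e0 gapL]] [u [v [Lu Lv d0]]].
have [xi xi0 cL] : exists2 xi, 0 < xi &
    forall t, L (cen t) <-> t / xi \is a Num.int.
  apply: (@cyclic_subgroup_real (fun t => L (cen t)) e) => //.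
  - by move=> s t Ls Lt; rewrite cenD cenN; apply: subgM => //; exact: subgV.
  - move=> s Ls se; have := gapL _ Ls; rewrite /= normr0 => /(_ e0 e0 se).
    by case.
  - by exists (hdet u v) => //; exact: subg_comm.
have gapxi s : s / xi \is a Num.int -> `|s| < xi -> s = 0.
  move=> si sxi; apply: contraTeq sxi => s0; rewrite -leNgt.
  have := norm_intr_ge1 si (mulf_neq0 s0 (invr_neq0 (lt0r_neq0 xi0))).
  by rewrite normrM normfV (gtr0_norm xi0) ler_pdivlMr// mul1r.
have detxi g h : L g -> L h -> hdet g h / xi \is a Num.int.
  by move=> Lg Lh; apply/cL; exact: subg_comm.
have [eta eta0 S1] : exists2 eta, 0 < eta & forall t,
    (exists2 w, L w & hdet u w = t) <-> t / eta \is a Num.int.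
  apply: (@cyclic_subgroup_real (fun t => exists2 w, L w & hdet u w = t) xi).
  - exact: xi0.
  - move=> s t [w Lw <-] [w' Lw' <-]; exists (w ** hinv w').
      by apply: subgM => //; exact: subgV.
    by rewrite /hdet /=; ring.
  - by move=> s [w Lw <-]; apply: gapxi; exact: detxi.
  - by exists (hdet u v) => //; exists v.
have [b Lb ub] : exists2 w, L w & hdet u w = eta.
  by apply/S1; rewrite divff ?lt0r_neq0// int_num1.
have [alpha alpha0 S2] : exists2 alpha, 0 < alpha & forall t,
    (exists2 w, L w & w.1.1 = t * u.1.1 /\ w.1.2 = t * u.1.2) <->
      t / alpha \is a Num.int.
  apply: (@cyclic_subgroup_real (fun t => exists2 w, L w &
    w.1.1 = t * u.1.1 /\ w.1.2 = t * u.1.2) (xi / `|hdet u v|)).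
  - by rewrite divr_gt0// normr_gt0.
  - move=> s t [w Lw [w1 w2]] [w' Lw' [w'1 w'2]]; exists (w ** hinv w').
      by apply: subgM => //; exact: subgV.
    by rewrite /= w1 w2 w'1 w'2; split; ring.
  - move=> s [w Lw [w1 w2]]; rewrite ltr_pdivlMr ?normr_gt0// -normrM => slt.
    have sdE : hdet w v = s * hdet u v by rewrite /hdet w1 w2; ring.
    have := gapxi _ (detxi _ _ Lw Lv); rewrite sdE => /(_ slt) /eqP.
    by rewrite mulf_eq0 (negPf d0) orbF => /eqP.
  - by exists 1; [exists u => //; rewrite !mul1r|exact: oner_neq0].
have [a La [a1 a2]] : exists2 w, L w &
    w.1.1 = alpha * u.1.1 /\ w.1.2 = alpha * u.1.2.
  by apply/S2; rewrite divff ?lt0r_neq0// int_num1.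
have abE : hdet a b = alpha * eta by rewrite -ub /hdet a1 a2; ring.
have etaN0 := lt0r_neq0 eta0; have alphaN0 := lt0r_neq0 alpha0.
have abN0 : hdet a b != 0 by rewrite abE mulf_neq0.
exists a, b, xi; split => // g Lg.
have ag : hdet a g / hdet a b = hdet u g / eta.
  have -> : hdet a g = alpha * hdet u g by rewrite /hdet a1 a2; ring.
  by rewrite abE; field; rewrite etaN0.
have gint : hdet u g / eta \is a Num.int by apply/S1; exists g.
split; last by rewrite ag.
have /intrP[m gm] := gint.
have [bm Lbm [bm1 bm2]] := subg_mulz sL (- m) Lb.
have gbE : hdet g b = hdet (g ** bm) b.
  by rewrite /hdet /= bm1 bm2; ring.
have ugbm : hdet u (g ** bm) = 0.
  have -> : hdet u (g ** bm) = hdet u g - m%:~R * hdet u b.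
    by rewrite /hdet /= bm1 bm2 intrN; ring.
  by rewrite ub -gm divfK// subrr.
have [g1 g2] := cramer (g ** bm) d0; rewrite ugbm mul0r !mul0r !addr0 in g1 g2.
(* As [p(g ** bm)] is a multiple of [p(u)], its coefficient is read off by taking determinants with
   [v]. *)
have -> : hdet g b / hdet a b = hdet (g ** bm) v / hdet u v / alpha.
  rewrite gbE {1}/hdet g1 g2 abE -ub /hdet; field.
  by rewrite -/(hdet u v) -/(hdet u b) ub d0 etaN0 alphaN0.
by apply/S2; exists (g ** bm) => //; exact: subgM.
Qed.

End Structure.

(** * Haar measure *)

Section Haar.
Variable R : realType.
Implicit Types (U : set (H3 R)).

(* [haar] lives on the product of copies of [measurableTypeR R], whose display
   differs from that of the canonical structure on [R * R * R]; [leb] and [mu]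
   are the same measures on the canonical measurable spaces. *)
Definition leb : set R -> \bar R := @lebesgue_measure R.

Let leb0 : leb set0 = 0%E. Proof. exact: measure0. Qed.
Let leb_ge0 (A : set R) : (0 <= leb A)%E. Proof. exact: measure_ge0. Qed.
Let leb_sigma_additive : semi_sigma_additive leb.
Proof. exact: (@measure_semi_sigma_additive _ _ _ (@lebesgue_measure R)). Qed.
HB.instance Definition _ := isMeasure.Build _ R R leb
  leb0 leb_ge0 leb_sigma_additive.

Let leb_sigma_finite : sigma_finite [set: R] leb.
Proof. exact: (@sigma_finiteT _ _ _ (@lebesgue_measure R)). Qed.
HB.instance Definition _ := Measure_isSigmaFinite.Build _ R R leb
  leb_sigma_finite.

Definition mu : set (H3 R) -> \bar R := @haar R.

Let mu0 : mu set0 = 0%E. Proof. exact: measure0. Qed.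
Let mu_ge0 U : (0 <= mu U)%E. Proof. exact: measure_ge0. Qed.
Let mu_sigma_additive : semi_sigma_additive mu.
Proof.
exact: (@measure_semi_sigma_additive _ _ _ ((@lebesgue_measure R \x
  @lebesgue_measure R) \x @lebesgue_measure R)%E).
Qed.
HB.instance Definition _ := isMeasure.Build _ (H3 R) R mu
  mu0 mu_ge0 mu_sigma_additive.

Lemma leb_itvco (a b : R) : leb `[a, b[%classic = if a < b then (b - a)%:E else 0%E.
Proof. by rewrite /leb lebesgue_measure_itv /= lte_fin EFinB. Qed.

Let leb2 : set (R * R) -> \bar R := (@lebesgue_measure R \x @lebesgue_measure R)%E.
Let leb20 : leb2 set0 = 0%E. Proof. exact: measure0. Qed.
Let leb2_ge0 A : (0 <= leb2 A)%E. Proof. exact: measure_ge0. Qed.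
Let leb2_sigma_additive : semi_sigma_additive leb2.
Proof.
exact: (@measure_semi_sigma_additive _ _ _ (@lebesgue_measure R \x
  @lebesgue_measure R)%E).
Qed.
HB.instance Definition _ := isMeasure.Build _ (R * R)%type R leb2
  leb20 leb2_ge0 leb2_sigma_additive.

Let leb2E (A B : set R) : measurable A -> measurable B ->
  leb2 (A `*` B) = (leb A * leb B)%E.
Proof. by move=> mA mB; rewrite /leb2 product_measure1E. Qed.

Let muE (A : set (R * R)) (B : set R) : measurable A -> measurable B ->
  mu (A `*` B) = (leb2 A * leb B)%E.
Proof. by move=> mA mB; rewrite /mu /haar product_measure1E. Qed.

Lemma mu_box (A B C : set R) : measurable A -> measurable B -> measurable C ->
  mu (A `*` B `*` C) = (leb A * leb B * leb C)%E.
Proof. by move=> mA mB mC; rewrite muE ?leb2E//; exact: measurableX. Qed.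

Definition cube (n : nat) : set R := `[- n%:R, n%:R]%classic.

Lemma measurable_cube n : measurable (cube n).
Proof. exact: measurable_itv. Qed.

Lemma leb_cube_lty n : (leb (cube n) < +oo)%E.
Proof.
by rewrite /leb lebesgue_measure_itv /=; case: ifP => _; rewrite -?EFinB ltry.
Qed.

Lemma cubeP (x : R) n : (Num.truncn `|x| < n)%N -> cube n x.
Proof.
move=> xn; rewrite /cube /= in_itv /= -ler_norml.
by rewrite (le_trans (ltW (truncnS_gt _)))// ler_nat.
Qed.

Let leb2_sigma_finite : sigma_finite [set: (R * R)%type] leb2.
Proof.
exists (fun n => cube n `*` cube n).
  apply/esym; rewrite -subTset => -[x y] _.
  exists (maxn (Num.truncn `|x|) (Num.truncn `|y|)).+1 => //.
  by split; apply: cubeP; rewrite /= ltnS !leq_max leqnn ?orbT.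
move=> n; have mC := measurable_cube n; split; first exact: measurableX.
rewrite leb2E// -ge0_fin_numE ?mule_ge0// fin_numM//;
  by rewrite ge0_fin_numE//; exact: leb_cube_lty.
Qed.
HB.instance Definition _ := Measure_isSigmaFinite.Build _ (R * R)%type R leb2
  leb2_sigma_finite.

Lemma mu_cube_lty n : (mu (cube n `*` cube n `*` cube n) < +oo)%E.
Proof.
have mC := measurable_cube n.
rewrite mu_box// -ge0_fin_numE ?mule_ge0// !fin_numM//;
  by rewrite ge0_fin_numE//; exact: leb_cube_lty.
Qed.

Let mu_sigma_finite : sigma_finite [set: H3 R] mu.
Proof.
exists (fun n => cube n `*` cube n `*` cube n).
  apply/esym; rewrite -subTset => -[[x y] z] _.
  exists (maxn (Num.truncn `|x|) (maxn (Num.truncn `|y|) (Num.truncn `|z|))).+1.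
    by [].
  by do !split; apply: cubeP; rewrite /= ltnS !leq_max leqnn ?orbT.
move=> n; have mC := measurable_cube n; split; last exact: mu_cube_lty.
by do 2?[apply: measurableX => //].
Qed.
HB.instance Definition _ := Measure_isSigmaFinite.Build _ (H3 R) R mu
  mu_sigma_finite.

Lemma leb_translation (a : R) (A : set R) : measurable A ->
  leb ((fun x => x + a) @^-1` A) = leb A.
Proof.
move=> mA; pose f : measurableTypeR R -> measurableTypeR R := fun x => x + a.
have mf : measurable_fun setT f by exact: measurable_funD.
pose fm : {mfun _ >-> _} := HB.pack f (isMeasurableFun.Build _ _ _ _ f mf).
apply/esym/(@lebesgue_measure_unique R (pushforward leb fm)) => // _ [[b c] _ <-].
have E : fm @^-1` `]b, c]%classic = `]b - a, c - a]%classic.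
  by apply/seteqP; split=> x /=; rewrite !in_itv /= ltrBlDr lerBrDr.
transitivity (leb `]b - a, c - a]%classic); last by rewrite -E.
rewrite /leb !lebesgue_measure_itv /= !lte_fin ltrD2r; case: ifP => // _.
by rewrite -!EFinB; congr (_%:E); ring.
Qed.

Let leb2_translation (a b : R) (A : set (R * R)) : measurable A ->
  leb2 ((fun x => (x.1 + a, x.2 + b)) @^-1` A) = leb2 A.
Proof.
move=> mA; pose f : R * R -> R * R := fun x => (x.1 + a, x.2 + b).
have mf : measurable_fun setT f.
  by apply/measurable_fun_pairP; split; exact: measurable_funD.
pose fm : {mfun _ >-> _} := HB.pack f (isMeasurableFun.Build _ _ _ _ f mf).
have E (m' : {measure set (R * R)%type -> \bar R}) : (forall B C, measurable B ->
    measurable C -> m' (B `*` C) = (leb B * leb C)%E) ->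
    forall X, measurable X -> (leb \x leb)%E X = m' X.
  by move=> m'E X mX; apply: product_measure_unique.
rewrite -[RHS](E leb2)//.
apply/esym; apply: (E (pushforward leb2 fm)) => // B C mB mC.
transitivity (leb2 (((fun x => x + a) @^-1` B) `*` ((fun x => x + b) @^-1` C))).
  by [].
by rewrite leb2E ?leb_translation//;
  rewrite -[X in measurable X]setTI; apply: measurable_funD.
Qed.

(** Left and right multiplications are shears with affine [f]; a quadratic [f] also gives the change
    of coordinates [z - x * y], used for subgroups whose (1,2) entries vanish. *)
Definition shear (a b : R) (f : R * R -> R) (g : H3 R) : H3 R :=
  (g.1.1 + a, g.1.2 + b, g.2 + f g.1).

Lemma measurable_shear a b f : measurable_fun setT f ->
  measurable_fun setT (shear a b f).
Proof.
move=> mf; apply/measurable_fun_pairP; split.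
  apply/measurable_fun_pairP; split; apply: measurable_funD => //;
    exact: measurableT_comp.
by apply: measurable_funD => //; exact: measurableT_comp.
Qed.

(** By Fubini: over each point of the base the fibre is translated by a constant, and the base
    itself is translated. *)
Lemma mu_shear a b f U : measurable_fun setT f -> measurable U ->
  mu (shear a b f @^-1` U) = mu U.
Proof.
move=> mf mU.
have muX X : measurable X -> mu X = (\int[leb2]_p leb (xsection X p))%E.
  by move=> mX; apply/esym; apply: (@product_measure_unique _ _ _ _ _ leb2 leb mu).
rewrite muX; last by rewrite -[X in measurable X]setTI; exact: measurable_shear.
rewrite muX//.
pose h : R * R -> R * R := fun x => (x.1 + a, x.2 + b).
have mh : measurable_fun setT h.
  by apply/measurable_fun_pairP; split; exact: measurable_funD.
pose hm : {mfun _ >-> _} := HB.pack h (isMeasurableFun.Build _ _ _ _ h mh).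
transitivity (\int[pushforward leb2 hm]_p leb (xsection U p))%E; last first.
  by apply: eq_measure_integral => A mA _; exact: leb2_translation.
rewrite ge0_integral_pushforward//=; last exact: measurable_fun_xsection.
apply: eq_integral => p _ /=.
rewrite -(leb_translation (f p) (measurable_xsection (h p) mU)).
by congr (leb _); apply/seteqP; split => z /=; rewrite /xsection /= !inE.
Qed.

End Haar.

(** * Volumes of sets that inject modulo a discrete subgroup *)

Section FundamentalDomains.
Variable R : realType.
Implicit Types (g h : H3 R) (L B C F U : set (H3 R)).
Local Notation mu := (@mu R).

Let hmulrE h : (fun g => g ** h) =
  shear h.1.1 h.1.2 (fun p => h.2 + p.1 * h.1.2).
Proof. by apply/funext => g; rewrite /hmul /shear addrA. Qed.

Let hmullE h : hmul h = shear h.1.1 h.1.2 (fun p => h.2 + h.1.1 * p.2).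
Proof. by apply/funext => g; rewrite /hmul /shear; congr (_, _, _); ring. Qed.

Let measurable_shearr h : measurable_fun setT (fun p : R * R => h.2 + p.1 * h.1.2).
Proof. by apply: measurable_funD => //; exact: measurable_funM. Qed.

Let measurable_shearl h : measurable_fun setT (fun p : R * R => h.2 + h.1.1 * p.2).
Proof. by apply: measurable_funD => //; exact: measurable_funM. Qed.

Lemma measurable_hmulr h : measurable_fun setT (fun g => g ** h).
Proof. by rewrite hmulrE; exact: measurable_shear. Qed.

Lemma measurable_hmull h : measurable_fun setT (hmul h).
Proof. by rewrite hmullE; exact: measurable_shear. Qed.

Lemma measurable_preim d1 d2 (T1 : measurableType d1) (T2 : measurableType d2)
    (f : T1 -> T2) A :
  measurable_fun setT f -> measurable A -> measurable (f @^-1` A).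
Proof. by move=> mf mA; rewrite -[X in measurable X]setTI; exact: mf. Qed.

Lemma mu_hmulr h U : measurable U -> mu ((fun g => g ** h) @^-1` U) = mu U.
Proof. by move=> mU; rewrite hmulrE mu_shear. Qed.

Lemma mu_hmull h U : measurable U -> mu (hmul h @^-1` U) = mu U.
Proof. by move=> mU; rewrite hmullE mu_shear. Qed.

Lemma floor_eq_dist (a b : R) : Num.floor a = Num.floor b -> `|a - b| < 1.
Proof.
move=> ab; have := floor_itv a; have := floor_itv b.
by rewrite ab !intrD => /andP[b1 b2] /andP[a1 a2]; rewrite ltr_norml; lra.
Qed.

(** Elements are coded by the cell of a grid that contains them. If [g] and [h] share a cell, then
    [hinv g ** h] is so close to the identity that it is trivial; its third entry is below
    [d + d * d], which dictates the choice of [d]. *)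
Lemma countable_discrete L : discrete_subgroup L -> countable L.
Proof.
move=> [sL [e e0 gap]].
pose d := Num.min e 1 / 2.
have min0 : 0 < Num.min e 1 by rewrite lt_min e0 ltr01.
have d0 : 0 < d by rewrite divr_gt0.
have de : d + d * d <= e.
  have : Num.min e 1 <= e by rewrite ge_min lexx.
  have : Num.min e 1 <= 1 by rewrite ge_min lexx orbT.
  by rewrite /d; nra.
pose i g := Num.floor (g.1.1 / d).
(* The mesh in the second coordinate shrinks as the first one grows, since the third entry of
   [hinv g ** h] contains [g.1.1] times the difference of the second coordinates. *)
pose j g := Num.floor (g.1.2 * (`|i g|%:~R + 1) / d).
pose k g := Num.floor (g.2 / d).
apply/countable_injP; exists (fun g => pickle (i g, j g, k g)).
move=> g h /set_mem Lg /set_mem Lh /(pcan_inj pickleK) [ij jj kj].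
have step (a b c : R) : 0 < c -> Num.floor (a * c / d) = Num.floor (b * c / d) ->
    `|b - a| * c < d.
  move=> c0 /esym /floor_eq_dist.
  rewrite -mulrBl -mulrBl normrM normfV (gtr0_norm d0) ltr_pdivrMr// mul1r.
  by rewrite normrM (gtr0_norm c0).
have dx : `|h.1.1 - g.1.1| < d.
  by rewrite -(mulr1 `|_|); apply: step => //; rewrite !mulr1.
have dz : `|h.2 - g.2| < d.
  by rewrite -(mulr1 `|_|); apply: step => //; rewrite !mulr1.
have m0 : 0 <= `|i g|%:~R :> R by rewrite ler0z.
have dy : `|h.1.2 - g.1.2| * (`|i g|%:~R + 1) < d.
  by apply: step; [lra|move: jj; rewrite /j ij].
have xb : `|g.1.1| <= (`|i g|%:~R + 1) * d.
  have -> : `|g.1.1| = `|g.1.1 / d| * d.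
    by rewrite normrM normfV (gtr0_norm d0) divfK ?lt0r_neq0.
  rewrite ler_pM2r//.
  have /andP[] := floor_itv (g.1.1 / d); rewrite -/(i g) intrD => f1 f2.
  have n1 : (i g)%:~R <= `|i g|%:~R :> R by rewrite ler_int ler_norm.
  have n2 : - (i g)%:~R <= `|i g|%:~R :> R.
    by rewrite -intrN ler_int -normrN ler_norm.
  by rewrite ler_norml; lra.
have dy' : `|h.1.2 - g.1.2| < d by have := normr_ge0 (h.1.2 - g.1.2); nra.
have xdy : `|g.1.1 * (h.1.2 - g.1.2)| <= d * d.
  rewrite normrM; have := normr_ge0 (h.1.2 - g.1.2).
  by have := normr_ge0 g.1.1; nra.
have gh1 : hinv g ** h = hone R.
  apply: gap; first by apply: subgM => //; exact: subgV.
  - by rewrite /= addrC; nra.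
  - by rewrite /= addrC; nra.
  - rewrite /= (_ : _ + _ = (h.2 - g.2) - g.1.1 * (h.1.2 - g.1.2)); last ring.
    by rewrite (le_lt_trans (ler_normB _ _))//; lra.
by rewrite -(mulVKh g h) gh1 mulh1.
Qed.

Definition injective_mod L B := forall b gam, B b -> L gam -> B (b ** gam) ->
  gam = hone R.

(** [B] is cut into countably many pieces according to the [gam] that carries [C] to them; each
    piece is translated back into [C], and injectivity of [B] keeps the translates disjoint. *)
Lemma mu_le_injective_mod L B C : subgroup L -> countable L ->
  measurable B -> measurable C -> injective_mod L B ->
  (forall b, B b -> exists c gam, [/\ C c, L gam & b = c ** gam]) ->
  (mu B <= mu C)%E.
Proof.
move=> sL /countable_injP[f finj] mB mC injB BC.
pose P n := [set gam | L gam /\ f gam = n].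
(* [e] inverts the enumeration [f] of [L]; its default value at integers outside the range of [f]
   never matters, as [Q] and [Q'] are empty there. *)
pose e n := xget (hone R) (P n).
pose Q n := if `[< exists gam, P n gam >] then C `&` (fun g => g ** e n) @^-1` B
  else set0.
pose Q' n := if `[< exists gam, P n gam >] then
  B `&` (fun g => g ** hinv (e n)) @^-1` C else set0.
have mQ n : measurable (Q n).
  rewrite /Q; case: ifP => // _; apply: measurableI => //.
  exact: (measurable_preim (measurable_hmulr _) mB).
have mQ' n : measurable (Q' n).
  rewrite /Q'; case: ifP => // _; apply: measurableI => //.
  exact: (measurable_preim (measurable_hmulr _) mC).
have QQ' n : mu (Q' n) = mu (Q n).
  rewrite -(mu_hmulr (e n) (mQ' n)) /Q /Q'; congr mu; case: ifP => // _.
  by apply/seteqP; split=> g [] /=; rewrite mulhK.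
have PE gam : L gam -> e (f gam) = gam.
  move=> Lgam; have [Le fe] : P (f gam) (e (f gam)).
    by apply: xgetPex; exists gam.
  by apply: finj => //; exact/mem_set.
have BQ : B `<=` \bigcup_n Q' n.
  move=> b Bb; have [c [gam [Cc Lgam bE]]] := BC _ Bb.
  exists (f gam) => //; rewrite /Q'; case: asboolP => [_|[]]; last by exists gam.
  by split => //=; rewrite PE// bE mulhK.
apply: (le_trans (measure_sigma_subadditive _ mQ' mB BQ)).
rewrite (eq_eseriesr (fun n _ => QQ' n)) -measure_semi_bigcup//; last 2 first.
  - apply/trivIsetP => n m _ _ nm; rewrite /Q.
    case: asboolP => [[x [Lx fx]]|_]; last by rewrite set0I.
    case: asboolP => [[y [Ly fy]]|_]; last by rewrite setI0.
    rewrite -subset0 => c [[_ /= B1] [_ /= B2]].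
    move/eqP: nm; apply; rewrite -fx -fy; congr f.
    move: B1 B2; rewrite -fx -fy !PE// => B1 B2.
    have := injB _ (hinv x ** y) B1; rewrite hmulA mulhK => /(_ _ B2) xy.
    by rewrite -(mulVKh x y) xy ?mulh1//; apply: subgM => //; exact: subgV.
  - exact: bigcup_measurable.
apply: le_measure; rewrite ?inE//; first exact: bigcup_measurable.
by move=> g [n _]; rewrite /Q; case: ifP => // _ [].
Qed.

Lemma fundamental_domain_inj L F : subgroup L -> fundamental_domain L F ->
  injective_mod L F.
Proof.
move=> sL [_ _ uF] b gam Fb Lgam Fbg.
have := uF _ _ (hone R) gam Fbg Fb (subg1 sL) Lgam.
by rewrite mulh1 => /(_ erefl) /(congr1 (fun x => hinv b ** x)); rewrite mulKh mulVh.
Qed.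

Lemma mu_fundamental_domain_eq L F F' U : subgroup L -> countable L ->
  fundamental_domain L F -> fundamental_domain L F' -> quot_borel L U ->
  mu (U `&` F) = mu (U `&` F').
Proof.
move=> sL cL.
suff H F1 F2 : fundamental_domain L F1 -> fundamental_domain L F2 ->
    quot_borel L U -> (mu (U `&` F1) <= mu (U `&` F2))%E.
  by move=> fF fF' qU; apply/eqP; rewrite eq_le !H.
move=> fF fF' [mU iU]; have [mF1 cF1 _] := fF; have [mF2 cF2 _] := fF'.
apply: (mu_le_injective_mod sL cL).
    exact: measurableI.
    exact: measurableI.
  move=> b gam [_ Fb] Lg [_ Fbg].
  exact: (fundamental_domain_inj sL fF Fb Lg Fbg).
move=> b [Ub Fb]; have [f [gam [Ff Lg bE]]] := cF2 b.
exists f, gam; split => //; split => //.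
by rewrite -(mulhK f gam) -bE; apply: iU => //; exact: subgV.
Qed.

Lemma mu_le_fundamental_domain L F B : subgroup L -> countable L ->
  fundamental_domain L F -> measurable B -> injective_mod L B -> (mu B <= mu F)%E.
Proof.
move=> sL cL [mF cF _] mB iB.
exact: (mu_le_injective_mod sL cL mB mF iB (fun b _ => cF b)).
Qed.

Lemma leb_itv0 (M : R) : 0 <= M -> leb `[0, M[%classic = M%:E.
Proof.
move=> M0; rewrite leb_itvco subr0; case: ltP => // M0'.
by congr EFin; apply/eqP; rewrite eq_le M0.
Qed.

Lemma itv0_dist (x y M : R) : x \in `[0, M[ -> y \in `[0, M[ -> `|y - x| < M.
Proof. by rewrite !in_itv /= ltr_norml; lra. Qed.

Lemma itv0_norm (x M : R) : x \in `[0, M[ -> `|x| < M.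
Proof. by rewrite in_itv /= ltr_norml; lra. Qed.

(** A small cube at the identity injects modulo [L]. Its first side has to be short as well because
    right multiplication by [gam] adds [b.1.1 * gam.1.2] to the third coordinate. *)
Lemma mu_fundamental_domain_gt0 L F : discrete_subgroup L ->
  fundamental_domain L F -> (0 < mu F)%E.
Proof.
move=> dL fF; have cL := countable_discrete dL; have [sL [e e0 gap]] := dL.
pose d := Num.min e 1 / 2.
have min0 : 0 < Num.min e 1 by rewrite lt_min e0 ltr01.
have d0 : 0 < d by rewrite divr_gt0.
have de : d + d * d <= e.
  have : Num.min e 1 <= e by rewrite ge_min lexx.
  have : Num.min e 1 <= 1 by rewrite ge_min lexx orbT.
  by rewrite /d; nra.
pose I : set R := `[0, d[%classic.
have mI : measurable I by exact: measurable_itv.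
apply: (@lt_le_trans _ _ (mu (I `*` I `*` I))).
  by rewrite mu_box// leb_itv0 ?ltW// -!EFinM lte_fin !mulr_gt0.
apply: (mu_le_fundamental_domain sL cL fF).
  by do 2?[apply: measurableX => //].
move=> b gam [[b1 b2] b3] Lg [[c1 c2] c3] /=.
have d1 : `|gam.1.1| < d.
  by have := itv0_dist b1 c1; rewrite /= addrAC subrr add0r.
have d2 : `|gam.1.2| < d.
  by have := itv0_dist b2 c2; rewrite /= addrAC subrr add0r.
have d3 := itv0_dist b3 c3; rewrite /= in d3.
have d4 : `|b.1.1| < d.
  exact: itv0_norm b1.
apply: gap => //.
- by nra.
- by nra.
- rewrite (_ : gam.2 = (b.2 + gam.2 + b.1.1 * gam.1.2 - b.2) - b.1.1 * gam.1.2).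
    rewrite (le_lt_trans (ler_normB _ _))// normrM.
    have := normr_ge0 b.1.1; have := normr_ge0 gam.1.2; nra.
  by ring.
Qed.

(* A discrete subgroup with collinear projections is contained in the kernel of
   a nonzero homomorphism onto R, along which boxes of arbitrarily large volume
   inject modulo the subgroup. *)
Lemma lattice_nonabelian L : lattice L ->
  exists u v, [/\ L u, L v & hdet u v != 0].
Proof.
move=> [dL [F fF]]; rewrite -/(mu F) => Ffin.
have cL := countable_discrete dL; have [sL [e e0 gap]] := dL.
apply: contrapT => Hno.
have det0 u v : L u -> L v -> hdet u v = 0.
  move=> Lu Lv; apply/eqP; apply/negPn/negP => uv; apply: Hno.
  by exists u, v.
suff [c c0 big] : exists2 c : R, 0 < c & forall M, 0 <= M ->
    exists B, [/\ measurable B, injective_mod L B & mu B = (c * M)%:E].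
  have Fge0 : (0 <= mu F)%E by exact: measure_ge0.
  pose V := fine (mu F).
  have FE : mu F = V%:E by rewrite fineK// ge0_fin_numE.
  have V0 : 0 <= V by rewrite fine_ge0.
  have M0 : 0 <= (V + 1) / c by rewrite divr_ge0 ?addr_ge0// ltW.
  have [B [mB iB muB]] := big _ M0.
  have := mu_le_fundamental_domain sL cL fF mB iB.
  by rewrite muB FE lee_fin mulrCA mulfV ?lt0r_neq0// mulr1; lra.
pose I (M : R) : set R := `[0, M[%classic.
have mI M : measurable (I M) by exact: measurable_itv.
have [[u [Lu u0]]|allx] := pselect (exists u, L u /\ u.1.1 != 0).
  pose s := u.1.2 / u.1.1.
  have slope g : L g -> g.1.2 = s * g.1.1.
    move=> Lg; have := det0 _ _ Lu Lg; rewrite /hdet /s => H.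
    by rewrite mulrAC; apply: (mulIf u0); rewrite divfK//; lra.
  have s0 : 0 <= `|s| by [].
  pose d := Num.min e 1 / (1 + `|s|).
  have min0 : 0 < Num.min e 1 by rewrite lt_min e0 ltr01.
  have d0 : 0 < d by rewrite divr_gt0//; lra.
  have de : d * (1 + `|s|) <= e by rewrite divfK ?ge_min ?lexx// lt0r_neq0//; lra.
  have d1 : d * (1 + `|s|) <= 1.
    by rewrite divfK ?ge_min ?lexx ?orbT// lt0r_neq0//; lra.
  exists (d * d); first exact: mulr_gt0.
  (* Here [p(L)] lies on a line of slope [s]. The long side is put in the second coordinate: the
     short first side bounds [gam.1.1], and the slope then bounds [gam.1.2] whatever [M] is. *)
  move=> M M0; exists (I d `*` I M `*` I d); split.
  - by do 2?[apply: measurableX => //].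
  - move=> b gam [[b1 b2] b3] Lg [[c1 c2] c3] /=.
    have x1 : `|gam.1.1| < d.
      by have := itv0_dist b1 c1; rewrite /= addrAC subrr add0r.
    have z1 := itv0_dist b3 c3; rewrite /= in z1.
    have x2 : `|b.1.1| < d.
      exact: itv0_norm b1.
    have y1 : `|gam.1.2| <= `|s| * d.
      by rewrite slope// normrM ler_wpM2l// ltW.
    have x0 := normr_ge0 b.1.1; have y0 := normr_ge0 gam.1.2.
    apply: gap => //; [nra|nra|].
    rewrite (_ : gam.2 = (b.2 + gam.2 + b.1.1 * gam.1.2 - b.2) - b.1.1 * gam.1.2).
      rewrite (le_lt_trans (ler_normB _ _))// normrM.
      have : `|b.1.1| * `|gam.1.2| <= 1 * (`|s| * d).
        by apply: ler_pM => //; nra.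
      nra.
    by ring.
  - rewrite mu_box// (leb_itv0 (ltW d0)) (leb_itv0 M0) -!EFinM.
    by congr EFin; ring.
have x0 g : L g -> g.1.1 = 0.
  move=> Lg; apply/eqP; apply/negPn/negP => g0; apply: allx.
  by exists g.
exists (e * e); first exact: mulr_gt0.
(* In the coordinate [z - x * y], right multiplication by an element with vanishing first entry is a
   pure translation, so the first side may be long. *)
move=> M M0; pose f (p : R * R) := - (p.1 * p.2).
have mf : measurable_fun setT f.
  by rewrite /f; apply: measurableT_comp => //; exact: measurable_funM.
have mB : measurable (I M `*` I e `*` I e) by do 2?[apply: measurableX => //].
exists (shear 0 0 f @^-1` (I M `*` I e `*` I e)); split.
- exact: (measurable_preim (measurable_shear _ _ mf) mB).
- move=> b gam [[b1 b2] b3] Lg [[c1 c2] c3] /=.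
  have g0 := x0 _ Lg.
  apply: gap => //; first by rewrite g0 normr0.
  + have := itv0_dist b2 c2; rewrite /= (_ : _ - _ = gam.1.2)//.
    by ring.
  + have := itv0_dist b3 c3; rewrite /= /f /= (_ : _ - _ = gam.2)//.
    by rewrite g0; ring.
- rewrite mu_shear// mu_box// (leb_itv0 (ltW e0)) (leb_itv0 M0) -!EFinM.
  by congr EFin; ring.
Qed.

Lemma lattice_has_basis L : lattice L -> exists a b xi, lattice_basis L a b xi.
Proof.
by move=> lL; apply: discrete_lattice_basis; [case: lL|exact: lattice_nonabelian].
Qed.

End FundamentalDomains.

(** * Fundamental domains and finite index *)

Section Index.
Variable R : realType.
Implicit Types (g h : H3 R) (L G B C F U : set (H3 R)) (r : nat -> H3 R).
Local Notation mu := (@mu R).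

Definition coset_reps L G (N : nat) r := [/\ (0 < N)%N,
  forall i, (i < N)%N -> L (r i),
  forall lam, L lam -> exists2 i, (i < N)%N & G (hinv (r i) ** lam) &
  forall i j, (i < N)%N -> (j < N)%N -> G (hinv (r i) ** r j) -> i = j].

Definition tiles F N r : set (H3 R) :=
  \bigcup_(i in `I_N) ((fun g => g ** hinv (r i)) @^-1` F).

Lemma measurable_tiles F N r : measurable F -> measurable (tiles F N r).
Proof.
move=> mF; apply: bigcup_measurable => i _.
exact: (measurable_preim (measurable_hmulr _) mF).
Qed.

(** Each piece of [U] is moved back into [F] by right translation. [U] is left arbitrary because the
    odometer measure applies this to sets invariant only under a deeper lattice. *)
Lemma mu_tiles L F N r U : subgroup L -> fundamental_domain L F ->
  (forall i, (i < N)%N -> L (r i)) ->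
  (forall i j, (i < N)%N -> (j < N)%N -> r i = r j -> i = j) -> measurable U ->
  mu (U `&` tiles F N r) =
    (\sum_(i < N) mu (F `&` (fun g => g ** r i) @^-1` U))%E.
Proof.
move=> sL fF Lr inj_r mU; have [mF _ _] := fF.
have mT i : measurable ((fun g => g ** hinv (r i)) @^-1` F).
  exact: (measurable_preim (measurable_hmulr _) mF).
rewrite setI_bigcupr bigcup_mkord
  (@measure_semi_additive_ord_I _ _ _ mu
    (fun i => U `&` (fun g => g ** hinv (r i)) @^-1` F)); last 3 first.
- by move=> k _; exact: measurableI.
- apply/trivIsetP => i j /= iN jN ij; rewrite -subset0 => g [[_ Fi] [_ Fj]].
  move/eqP: ij; apply; apply: inj_r => //.
  have := fundamental_domain_inj sL fF Fi (gam := r i ** hinv (r j)).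
  rewrite hmulA mulhVK => /(_ _ Fj) H.
  have {}H : r i ** hinv (r j) = hone R.
    by apply: H; apply: subgM => //; [exact: Lr|apply: subgV => //; exact: Lr].
  by rewrite -(mulhVK (r i) (r j)) H mul1h.
- by apply: bigsetU_measurable => i _; exact: measurableI.
apply: eq_bigr => i _.
have mUT : measurable (U `&` (fun g => g ** hinv (r i)) @^-1` F) by exact: measurableI.
rewrite -[LHS](mu_hmulr (r i) mUT).
by congr mu; apply/seteqP; split=> g [] /=; rewrite mulhK.
Qed.

Lemma fundamental_domain_unique L F f g lam : subgroup L ->
  fundamental_domain L F -> F f -> F g -> L lam -> f = g ** lam ->
  f = g /\ lam = hone R.
Proof.
move=> sL fF Ff Fg Ll fE.
have lam1 : lam = hone R by apply: (fundamental_domain_inj sL fF Fg Ll); rewrite -fE.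
by rewrite fE lam1 mulh1.
Qed.

Lemma tiles_fundamental_domain L G F N r : subgroup L -> subgroup G -> G `<=` L ->
  fundamental_domain L F -> coset_reps L G N r ->
  fundamental_domain G (tiles F N r).
Proof.
move=> sL sG GL fF [N0 Lr cr ur]; have [mF cF uF] := fF; split.
- exact: measurable_tiles.
- move=> g; have [f [lam [Ff Llam gE]]] := cF g.
  have [i iN Gi] := cr _ Llam.
  exists (f ** r i), (hinv (r i) ** lam); split => //.
    by exists i => //; rewrite /preimage/= mulhK.
  by rewrite gE -hmulA mulVKh.
- move=> f1 f2 g1 g2 [i /= iN Fi] [j /= jN Fj] G1 G2 E.
  have [gam Ggam f1E] : exists2 gam, G gam & f1 = f2 ** gam.
    exists (g2 ** hinv g1); last by rewrite hmulA -E mulhK.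
    by apply: subgM => //; exact: subgV.
  have [] := @fundamental_domain_unique L F (f1 ** hinv (r i)) (f2 ** hinv (r j))
    (r j ** gam ** hinv (r i)) sL fF Fi Fj.
  + apply: subgM => //; last by apply: subgV => //; exact: Lr.
    by apply: subgM => //; [exact: Lr|exact: GL].
  + by rewrite !hmulA mulhVK f1E.
  move=> _ /(congr1 (fun x => x ** r i)); rewrite mulhVK mul1h => rE.
  have ji : j = i by apply: ur => //; rewrite -rE mulKh.
  have gam1 : gam = hone R by rewrite -(mulKh (r j) gam) rE ji mulVh.
  by rewrite f1E gam1 mulh1.
Qed.

Lemma mu_tilesI L F N r U : subgroup L -> fundamental_domain L F ->
  (forall i, (i < N)%N -> L (r i)) ->
  (forall i j, (i < N)%N -> (j < N)%N -> r i = r j -> i = j) -> quot_borel L U ->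
  mu (U `&` tiles F N r) = (N%:R%:E * mu (U `&` F))%E.
Proof.
move=> sL fF Lr inj_r [mU iU]; rewrite (mu_tiles sL fF)//.
rewrite (eq_bigr (fun=> mu (U `&` F))) => [|i _].
  by rewrite sumr_const card_ord mule_natl.
rewrite setIC; congr mu; apply/seteqP; split=> g [] /= Ug Fg; split => //.
  by rewrite -(mulhK g (r i)); apply: iU => //; apply: subgV => //; exact: Lr.
by apply: iU => //; exact: Lr.
Qed.

(** Finite index comes from volume: [n] pairwise inequivalent elements give [n] disjoint tiles whose
    union injects modulo [G], so [n] is at most the ratio of the covolumes. A family of maximal size
    meets every coset. *)
Lemma ex_coset_reps L G : lattice L -> lattice G -> G `<=` L ->
  exists N r, coset_reps L G N r.
Proof.
move=> [dL [F fF]]; rewrite -/(mu F) => Ffin [dG [FG fG]].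
rewrite -/(mu FG) => FGfin GL.
have [sL _] := dL; have [sG _] := dG.
have cG := countable_discrete dG.
have [mF _ _] := fF.
pose indep n r := (forall i, (i < n)%N -> L (r i)) /\
  forall i j, (i < n)%N -> (j < n)%N -> G (hinv (r i) ** r j) -> i = j.
have muF0 := mu_fundamental_domain_gt0 dL fF.
have bound n : (exists r, indep n r) -> (n%:R%:E * mu F <= mu FG)%E.
  move=> [r [Lr ur]].
  have inj_r i j : (i < n)%N -> (j < n)%N -> r i = r j -> i = j.
    by move=> iN jN rE; apply: ur => //; rewrite rE mulVh; exact: subg1.
  have <- : mu (tiles F n r) = (n%:R%:E * mu F)%E.
    have := mu_tilesI sL fF Lr inj_r (U := setT); rewrite !setTI; apply.
    by split => //; exact: measurableT.
  apply: (mu_le_fundamental_domain sG cG fG); first exact: measurable_tiles.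
  move=> b gam [i /= iN Fi] Gg [j /= jN Fj].
  have [] := @fundamental_domain_unique L F (b ** gam ** hinv (r j))
    (b ** hinv (r i)) (r i ** gam ** hinv (r j)) sL fF Fj Fi.
  + apply: subgM => //; last by apply: subgV => //; exact: Lr.
    by apply: subgM => //; [exact: Lr|exact: GL].
  + by rewrite !hmulA mulhVK.
  move=> _ /(congr1 (fun x => x ** r j)); rewrite mulhVK mul1h => rE.
  have ij : i = j by apply: ur => //; rewrite -rE mulKh.
  by rewrite -(mulKh (r i) gam) rE ij mulVh.
pose c := fine (mu F); pose V := fine (mu FG).
have cE : mu F = c%:E by rewrite fineK// ge0_fin_numE.
have VE : mu FG = V%:E by rewrite fineK// ge0_fin_numE.
have c0 : 0 < c by move: muF0; rewrite cE lte_fin.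
pose P n := `[< exists r, indep n r >].
have P1 : exists n, P n.
  exists 0; apply/asboolP; exists (fun=> hone R); split => //.
have Pb n : P n -> (n <= Num.truncn (V / c))%N.
  move=> /asboolP /bound; rewrite cE VE -EFinM lee_fin -ler_pdivlMr// => nV.
  by rewrite -(@natrK R n); exact: le_truncn.
case: (ex_maxnP P1 Pb) => N /asboolP [r [Lr ur]] maxN.
have cov lam : L lam -> exists2 i, (i < N)%N & G (hinv (r i) ** lam).
  move=> Ll; apply: contrapT => Hno.
  suff /maxN : P N.+1 by rewrite ltnn.
  apply/asboolP; exists (fun i => if i == N then lam else r i).
  have lt i : (i < N.+1)%N -> i != N -> (i < N)%N by move=> *; lia.
  split => [i iN|i j iN jN]; first by case: eqVneq => // /(lt _ iN) /Lr.
  case: (eqVneq i N) => [->|/(lt _ iN) iN']; case: (eqVneq j N) => [->|/(lt _ jN) jN'] //.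
  - move=> /(subgV sG); rewrite hinvM hinvK => Gj.
    by exfalso; apply: Hno; exists j.
  - by move=> Gi; exfalso; apply: Hno; exists i.
  - exact: ur.
exists N, r; split => //.
by have [i iN _] := cov _ (subg1 sL); apply: leq_ltn_trans iN.
Qed.

Lemma mu_index L G N r FL FG U : subgroup L -> discrete_subgroup G -> G `<=` L ->
  coset_reps L G N r -> fundamental_domain L FL -> fundamental_domain G FG ->
  quot_borel L U -> mu (U `&` FG) = (N%:R%:E * mu (U `&` FL))%E.
Proof.
move=> sL dG GL cr fL fG [mU iU]; have [sG _] := dG.
have [N0 Lr _ ur] := cr.
have inj_r i j : (i < N)%N -> (j < N)%N -> r i = r j -> i = j.
  by move=> iN jN rE; apply: ur => //; rewrite rE mulVh; exact: subg1.
rewrite -(mu_tilesI sL fL Lr inj_r)//.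
apply: (mu_fundamental_domain_eq sG (countable_discrete dG) fG).
  exact: (tiles_fundamental_domain sL sG GL fL cr).
by split => // g gam Ug Gg; apply: iU => //; exact: GL.
Qed.

Lemma quot_borelT L : quot_borel L setT.
Proof. by split => //; exact: measurableT. Qed.

Lemma mu_ratio L G FL FG U : lattice L -> lattice G -> G `<=` L ->
  fundamental_domain L FL -> fundamental_domain G FG ->
  quot_borel L U -> (mu (U `&` FG) * mu FL = mu (U `&` FL) * mu FG)%E.
Proof.
move=> lL lG GL fL fG qU.
have [N [r cr]] := ex_coset_reps lL lG GL.
have [[sL _] _] := lL; have [dG _] := lG.
rewrite (mu_index sL dG GL cr fL fG qU).
have := mu_index sL dG GL cr fL fG (quot_borelT L).
by rewrite !setTI => ->; rewrite -muleA muleCA.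
Qed.

End Index.

(** * The fundamental domain given by a basis *)

Section BasisDomain.
Variable R : realType.
Implicit Types (g h a b : H3 R) (L F U : set (H3 R)).
Local Notation mu := (@mu R).

Lemma measurable_hdetl b : measurable_fun setT (fun g : H3 R => hdet g b).
Proof.
rewrite /hdet; apply: measurable_funB; apply: measurable_funM => //.
  exact: (measurableT_comp measurable_fst measurable_fst).
exact: (measurableT_comp measurable_snd measurable_fst).
Qed.

Lemma measurable_hdetr a : measurable_fun setT (fun g : H3 R => hdet a g).
Proof.
rewrite (_ : (fun _ => _) = (fun g => - hdet g a)).
  by apply: measurable_funN; exact: measurable_hdetl.
by apply/funext => g; rewrite /hdet; ring.
Qed.

Lemma hdetMl g h b : hdet (g ** h) b = hdet g b + hdet h b.
Proof. by rewrite /hdet /=; ring. Qed.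

Lemma hdetMr a g h : hdet a (g ** h) = hdet a g + hdet a h.
Proof. by rewrite /hdet /=; ring. Qed.

Lemma subg_coords L a b (m n : int) : subgroup L -> L a -> L b -> hdet a b != 0 ->
  exists2 s, L s & hdet s b / hdet a b = m%:~R /\ hdet a s / hdet a b = n%:~R.
Proof.
move=> sL La Lb d0.
have [w Lw [w1 w2]] := subg_mulz sL m La; have [v Lv [v1 v2]] := subg_mulz sL n Lb.
exists (w ** v); first exact: subgM.
have -> : hdet (w ** v) b = m%:~R * hdet a b.
  by rewrite /hdet /= w1 w2 v1 v2; ring.
have -> : hdet a (w ** v) = n%:~R * hdet a b.
  by rewrite /hdet /= w1 w2 v1 v2; ring.
by rewrite !mulfK.
Qed.

Lemma int_dist_lt1 (x y : R) : x \is a Num.int -> y \in `[0, 1[ ->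
  y + x \in `[0, 1[ -> x = 0.
Proof.
rewrite !in_itv /= => xi y01 yx01; apply/eqP; apply/negPn/negP => x0.
have := norm_intr_ge1 xi x0; have : `|x| < 1 by rewrite ltr_norml; lra.
lra.
Qed.

Lemma hdet0_cen a b g : hdet a b != 0 -> hdet g b / hdet a b = 0 ->
  hdet a g / hdet a b = 0 -> g = cen g.2.
Proof.
move=> d0 ga gb; have [] := cramer g d0.
rewrite ga gb !mul0r addr0 => g1 g2.
by case: g g1 g2 {ga gb} => [[x y] z] /= -> ->.
Qed.

Definition basis_box a b xi : set (H3 R) :=
  [set g | [/\ hdet g b / hdet a b \in `[0, 1[, hdet a g / hdet a b \in `[0, 1[
    & g.2 / xi \in `[0, 1[ ] ].

(** The integer parts of the two Cramer coordinates are removed first and that of the central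
    coordinate last, because the former reduction changes the third entry while a central factor
    leaves the projection alone. *)
Lemma basis_box_fundamental_domain L a b xi : subgroup L -> lattice_basis L a b xi ->
  fundamental_domain L (basis_box a b xi) /\ (mu (basis_box a b xi) < +oo)%E.
Proof.
move=> sL bL; have [[La Lb] d0 intL xi0 cL] := bL.
have mI : measurable (`[0, 1[%classic : set R) by exact: measurable_itv.
have mbox : measurable (basis_box a b xi).
  rewrite (_ : basis_box a b xi =
    (fun g => hdet g b / hdet a b) @^-1` `[0, 1[%classic `&`
    (fun g => hdet a g / hdet a b) @^-1` `[0, 1[%classic `&`
    (fun g : H3 R => g.2 / xi) @^-1` `[0, 1[%classic); last first.
    by apply/seteqP; split => g /= [] // [].
  apply: measurableI; first apply: measurableI;
    apply: measurable_preim mI; apply: measurable_funM => //.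
  - exact: measurable_hdetl.
  - exact: measurable_hdetr.
split; first split => //.
- move=> g; pose m := Num.floor (hdet g b / hdet a b).
  pose n := Num.floor (hdet a g / hdet a b).
  have [s Ls [s1 s2]] := subg_coords m n sL La Lb d0.
  pose g' := g ** hinv s; pose k := Num.floor (g'.2 / xi).
  have Lc : L (cen (k%:~R * xi)) by apply/cL; rewrite mulfK ?lt0r_neq0// intr_int.
  exists (g' ** cen (- (k%:~R * xi))), (cen (k%:~R * xi) ** s); split.
  + have fr (x : R) : x - (Num.floor x)%:~R \in `[0, 1[.
      by have := floor_itv x; rewrite in_itv intrD /=; lra.
    split.
    * rewrite /= (_ : _ / _ = hdet g b / hdet a b - hdet s b / hdet a b).
        by rewrite s1.
      by rewrite -mulrBl; congr (_ / _); rewrite /hdet /=; ring.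
    * rewrite /= (_ : _ / _ = hdet a g / hdet a b - hdet a s / hdet a b).
        by rewrite s2.
      by rewrite -mulrBl; congr (_ / _); rewrite /hdet /=; ring.
    * rewrite /= (_ : _ / _ = g'.2 / xi - k%:~R) //.
      by rewrite /=; field; rewrite lt0r_neq0.
  + exact: subgM.
  + by rewrite hmulA -(hmulA g') -cenD addNr mulh1 mulhVK.
- move=> f1 f2 g1 g2 [x1 y1 z1] [x2 y2 z2] L1 L2 E.
  have [gam Lgam f1E] : exists2 gam, L gam & f1 = f2 ** gam.
    exists (g2 ** hinv g1); last by rewrite hmulA -E mulhK.
    by apply: subgM => //; exact: subgV.
  have [i1 i2] := intL _ Lgam.
  have x0 := int_dist_lt1 i1 x2; have y0 := int_dist_lt1 i2 y2.
  rewrite -mulrDl -hdetMl -f1E in x0; rewrite -mulrDl -hdetMr -f1E in y0.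
  have gE := hdet0_cen d0 (x0 x1) (y0 y1).
  have z0 : gam.2 / xi = 0.
    apply: (int_dist_lt1 _ z2); first by apply/cL; rewrite -gE.
    move: z1; rewrite f1E gE /= mulr0 addr0.
    by rewrite mulrDl.
  rewrite f1E gE (_ : gam.2 = 0) ?mulh1//.
  by apply/eqP; move/eqP: z0; rewrite mulf_eq0 invr_eq0 (gt_eqF xi0) orbF.
pose M : R := `|a.1.1| + `|b.1.1| + `|a.1.2| + `|b.1.2| + xi.
pose n := (Num.truncn M).+1.
apply: le_lt_trans (@mu_cube_lty R n).
have mC := @measurable_cube R n.
apply: le_measure; rewrite ?inE//; first by do 2?[apply: measurableX => //].
move=> g [x y z]; have [g1 g2] := cramer g d0.
move: x y z; rewrite !in_itv /= => x y z.
have nM : M < n%:R by exact: truncnS_gt.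
have bd (s t u v : R) : 0 <= s < 1 -> 0 <= t < 1 -> `|s * u + t * v| <= `|u| + `|v|.
  move=> s1 t1; rewrite (le_trans (ler_normD _ _))// !normrM.
  rewrite (ger0_norm (x := s)) ?(ger0_norm (x := t)); [|lra|lra].
  by have := normr_ge0 u; have := normr_ge0 v; nra.
have := bd _ _ a.1.1 b.1.1 x y; have := bd _ _ a.1.2 b.1.2 x y.
rewrite -g1 -g2 /M in nM * => b2 b1.
have := normr_ge0 a.1.1; have := normr_ge0 b.1.1.
have := normr_ge0 a.1.2; have := normr_ge0 b.1.2 => n1 n2 n3 n4.
have z' : 0 <= g.2 < xi.
  move: z; rewrite ltr_pdivrMr// mul1r => /andP[z ->]; rewrite andbT.
  by rewrite -(divfK (lt0r_neq0 xi0) g.2) mulr_ge0// ltW.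
by do !split; rewrite /cube /= in_itv /= -ler_norml; [lra|lra|];
  rewrite ger0_norm; lra.
Qed.

Lemma lattice_of_basis L a b xi : discrete_subgroup L -> lattice_basis L a b xi ->
  lattice L.
Proof.
move=> dL bL; split => //; have [sL _] := dL.
by have [fd fin] := basis_box_fundamental_domain sL bL; exists (basis_box a b xi).
Qed.

Lemma lattice_subgroup L : lattice L -> subgroup L.
Proof. by move=> [[]]. Qed.

(** Discreteness comes from the larger lattice and two noncollinear projections from the smaller
    one; this recognizes the interleaved groups as lattices. *)
Lemma lattice_between L G G' : lattice G -> lattice G' -> subgroup L ->
  G `<=` L -> L `<=` G' -> lattice L.
Proof.
move=> lG [[sG' [e e0 gap]] _] sL GL LG'.
have dL : discrete_subgroup L.
  by split => //; exists e => // g Lg; apply: gap; exact: LG'.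
have [u [v [Gu Gv uv]]] := lattice_nonabelian lG.
have [a [b [xi bL]]] : exists a b xi, lattice_basis L a b xi.
  by apply: discrete_lattice_basis => //; exists u, v; split => //; exact: GL.
exact: lattice_of_basis bL.
Qed.

End BasisDomain.

(** * Existence of the odometer measure *)

Section Cosets.
Variable R : realType.
Implicit Types (g h : H3 R) (L U : set (H3 R)) (G : nat -> set (H3 R)).

Lemma lcoset_refl L g : subgroup L -> lcoset L g g.
Proof. by move=> sL; exists (hone R); [exact: subg1|exact: mulh1]. Qed.

Lemma lcosetP L g h : lcoset L g h <-> L (hinv g ** h).
Proof.
split; first by case=> gam Lg <-; rewrite mulKh.
by move=> Lgh; exists (hinv g ** h) => //; rewrite mulVKh.
Qed.

Lemma lcoset_eq L g h : subgroup L -> lcoset L g h -> lcoset L g = lcoset L h.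
Proof.
move=> sL /lcosetP Lgh; apply/seteqP; split=> x /lcosetP Lx; apply/lcosetP.
  rewrite (_ : _ ** x = hinv (hinv g ** h) ** (hinv g ** x)).
    by apply: subgM => //; exact: subgV.
  by rewrite hinvM hinvK -hmulA mulVKh.
rewrite (_ : _ ** x = (hinv g ** h) ** (hinv h ** x)); first exact: subgM.
by rewrite -hmulA mulVKh.
Qed.

Lemma lcoset_subset L U g : subgroup L ->
  (forall g gam, U g -> L gam -> U (g ** gam)) -> lcoset L g `<=` U <-> U g.
Proof.
move=> sL iU; split=> [|Ug x [gam Lg <-]]; last exact: iU.
by apply; exact: lcoset_refl.
Qed.

Lemma nested_le G i j : nested_lattices G -> (i <= j)%N -> G j `<=` G i.
Proof.
move=> [_ nG]; elim: j => [|j IH]; first by rewrite leqn0 => /eqP ->.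
rewrite leq_eqVlt => /orP[/eqP ->//|]; rewrite ltnS => /IH.
by move=> + g Gg; apply; exact: nG.
Qed.

Lemma odo_le G (x : odo G) i j : (i <= j)%N -> proj1_sig x j `<=` proj1_sig x i.
Proof.
case: x => x [_ nx] /=; elim: j => [|j IH]; first by rewrite leqn0 => /eqP ->.
rewrite leq_eqVlt => /orP[/eqP ->//|]; rewrite ltnS => /IH.
by move=> + g Gg; apply; exact: nx.
Qed.

Lemma odo_coset G (x : odo G) j : exists g, proj1_sig x j = lcoset (G j) g.
Proof. by case: x => x []. Qed.

Lemma odo_eq G (x y : odo G) :
  (forall j, proj1_sig x j = proj1_sig y j) -> x = y.
Proof.
case: x y => [x hx] [y hy] /= /funext xy; subst y.
by congr exist; exact: Prop_irrelevance.
Qed.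

Definition odo_gen G : set (set (odo G)) :=
  fun A => exists j U, quot_borel (G j) U /\ A = @cyl R G j U.

Lemma odo_meas_cyl G j U : quot_borel (G j) U -> odo_meas (@cyl R G j U).
Proof. by move=> qU; apply: sub_sigma_algebra; exists j, U. Qed.

Lemma odo_meas_induction G (P : set (set (odo G))) : sigma_algebra setT P ->
  (forall j U, quot_borel (G j) U -> P (@cyl R G j U)) ->
  forall A, odo_meas A -> P A.
Proof.
move=> sP gP A; apply: smallest_sub => // _ [j [U [qU ->]]].
exact: gP.
Qed.

End Cosets.

Section OdometerMeasure.
Variable R : realType.
Implicit Types (g h : H3 R) (L U F : set (H3 R)) (r : nat -> H3 R).
Local Notation mu := (@mu R).
Local Notation leb := (@leb R).

(** Dropping the last mixed-radix digit at one level yields the digits at the previous level.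
    Negative [v] is covered because [truncn] vanishes there, so every real number yields a point of
    the inverse limit. *)
Lemma truncn_divn (v : R) (N : nat) : (0 < N)%N ->
  (Num.truncn (v * N%:R) %/ N)%N = Num.truncn v.
Proof.
move=> N0; have N0' : 0 < N%:R :> R by rewrite ltr0n.
case: (ltP v 0) => v0.
  have T0 (x : R) : x < 0 -> Num.truncn x = 0%N.
    by move=> x0; apply/truncn0Pn; rewrite -ltNge; lra.
  by rewrite !T0 ?div0n// pmulr_llt0.
set t := Num.truncn _; have /andP[t1 t2] := truncn_itv (mulr_ge0 v0 (ltW N0')).
apply/esym/truncn_def; rewrite -(ler_pM2r N0') -(ltr_pM2r N0') -!natrM.
apply/andP; split; first by rewrite (le_trans _ t1)// ler_nat leq_trunc_div.
by apply: (lt_le_trans t2); rewrite ler_nat ltn_ceil.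
Qed.

(* A point of the inverse limit is given by g in H_3(R), which selects the coset
   at level 0, and by the digits of a real number u in the mixed radix system of
   the indices of G_(j+1) in G_j; the product of Haar and Lebesgue measures on
   F0 x [0, 1[ is pushed forward to the odometer. *)
Section Digits.
Variables (G : nat -> set (H3 R)) (nG : nested_lattices G).
Variables (N : nat -> nat) (r : nat -> nat -> H3 R).
Hypothesis repsNr : forall j, coset_reps (G j) (G j.+1) (N j) (r j).

Let sG j : subgroup (G j). Proof. by apply: lattice_subgroup; case: nG. Qed.
Let GS j : G j.+1 `<=` G j. Proof. by case: nG. Qed.
Let N_gt0 j : (0 < N j)%N. Proof. by case: (repsNr j). Qed.

Fixpoint radix (j : nat) : nat := if j is k.+1 then (radix k * N k)%N else 1%N.

(** The leading digit selects the coset at the coarsest level, so passing to a coarser quotient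
    deletes the last factor. *)
Fixpoint digit_rep (j i : nat) : H3 R :=
  if j is k.+1 then digit_rep k (i %/ N k) ** r k (i %% N k) else hone R.

Lemma digit_reps j : coset_reps (G 0) (G j) (radix j) (digit_rep j).
Proof.
elim: j => [|j [IH0 IHL IHc IHu]].
  split => //; first by move=> i _; exact: subg1.
    by move=> lam Gl; exists 0; rewrite //= hinv1 mul1h.
  by move=> [|i] [|j].
have [N0 Nr Nc Nu] := repsNr j.
have G0 : G j `<=` G 0 by exact: nested_le.
have divlt i : (i < radix j * N j)%N -> (i %/ N j < radix j)%N by rewrite ltn_divLR.
have modlt i : (i %% N j < N j)%N by rewrite ltn_mod.
split => /=.
- by rewrite muln_gt0 IH0.
- move=> i /divlt iN; apply: subgM; [exact: sG|exact: IHL|].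
  by apply: G0; exact: Nr.
- move=> lam /IHc[i1 i1M G1]; have [i2 i2N G2] := Nc _ G1.
  exists (i1 * N j + i2)%N.
    by rewrite (@leq_trans (i1.+1 * N j))//; [rewrite mulSn addnC ltn_add2r|exact: leq_mul].
  by rewrite divnMDl// divn_small// addn0 modnMDl modn_small// hinvM -hmulA.
- move=> i k /divlt iM /divlt kM.
  rewrite hinvM -hmulA => H.
  have qE : (i %/ N j)%N = (k %/ N j)%N.
    apply: IHu => //; set a := hinv (digit_rep _ _) ** _.
    have -> : a = r j (i %% N j) ** (hinv (r j (i %% N j)) ** (hinv (digit_rep j
        (i %/ N j)) ** (digit_rep j (k %/ N j) ** r j (k %% N j))))
        ** hinv (r j (k %% N j)).
      by rewrite mulVKh hmulA mulhK.
    apply: subgM => //; last by apply: subgV => //; exact: Nr.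
    by apply: subgM => //; [exact: Nr|exact: GS].
  rewrite (divn_eq i (N j)) (divn_eq k (N j)) qE; congr addn.
  by move: H; rewrite qE mulKh => /Nu; apply.
Qed.

Definition digit_point (p : H3 R * R) (j : nat) : set (H3 R) :=
  lcoset (G j) (p.1 ** digit_rep j (Num.truncn (p.2 * (radix j)%:R))).

Lemma digit_point_inv_lim p : inv_lim G (digit_point p).
Proof.
split=> j; first by eexists.
apply/lcoset_subset => //.
  move=> g gam /lcosetP Lg Gg; apply/lcosetP; rewrite hmulA.
  by apply: subgM => //; exact: GS.
apply/lcosetP; rewrite /= natrM mulrA truncn_divn// hinvM -hmulA mulKh mulKh.
by have [_ + _ _] := repsNr j; apply; rewrite ltn_mod.
Qed.

Definition digit_odo p : odo G := exist _ (digit_point p) (digit_point_inv_lim p).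

Lemma digit_odo_cyl j U : quot_borel (G j) U -> digit_odo @^-1` (@cyl R G j U) =
  [set p | U (p.1 ** digit_rep j (Num.truncn (p.2 * (radix j)%:R)))].
Proof.
move=> [_ iU]; apply/seteqP.
by split=> p /=; rewrite /cyl /= /digit_point /= lcoset_subset.
Qed.

Let radix_gt0 j : (0 < radix j)%N. Proof. by case: (digit_reps j). Qed.

Let measurable_digit j i : measurable
  [set u : R | Num.truncn (u * (radix j)%:R) = i].
Proof.
have mM : measurable_fun setT (fun u : R => u * (radix j)%:R).
  exact: measurable_funM.
have mT : measurable [set v : R | Num.truncn v = i].
  case: i => [|i].
    rewrite (_ : [set _ | _] = `]-oo, 1[%classic); first exact: measurable_itv.
    apply/seteqP; split=> v /=; rewrite in_itv /=.
      by move=> /truncn0Pn; rewrite -ltNge.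
    by move=> v1; apply/truncn0Pn; rewrite -ltNge.
  rewrite (_ : [set _ | _] = `[i.+1%:R, i.+2%:R[%classic); first exact: measurable_itv.
  apply/seteqP; split=> v /=; rewrite in_itv /=; last exact: truncn_def.
  case: (ltP v 0) => [v0|v0 <-]; last exact: truncn_itv.
  have /truncn0Pn -> // : ~~ (1 <= v) by rewrite -ltNge; lra.
exact: (measurable_preim mM mT).
Qed.

Let measurable_digit_cyl j U : quot_borel (G j) U ->
  measurable (digit_odo @^-1` (@cyl R G j U)).
Proof.
move=> qU; rewrite digit_odo_cyl//; have [mU _] := qU.
rewrite (_ : [set _ | _] = \bigcup_i ((fun g => g ** digit_rep j i) @^-1` U `*`
    [set u : R | Num.truncn (u * (radix j)%:R) = i])).
  apply: bigcup_measurable => i _; apply: measurableX => //.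
  exact: (measurable_preim (measurable_hmulr _) mU).
apply/seteqP; split=> [[g u] /= Ug|[g u] [i _ [/= Ug ui]]]; last by rewrite ui.
by exists (Num.truncn (u * (radix j)%:R)).
Qed.

Lemma measurable_digit_odo A : odo_meas A -> measurable (digit_odo @^-1` A).
Proof.
apply: (odo_meas_induction (P := [set A | measurable (digit_odo @^-1` A)])) => //.
split=> /=.
- by rewrite preimage_set0; exact: measurable0.
- by move=> B mB; rewrite setTD preimage_setC; exact: measurableC.
- by move=> B mB; rewrite preimage_bigcup; exact: bigcup_measurable.
Qed.

Variable F0 : set (H3 R).
Hypotheses (fF0 : fundamental_domain (G 0) F0) (F0fin : (mu F0 < +oo)%E).

Let c := fine (mu F0).
Let muF0 : mu F0 = c%:E. Proof. by rewrite fineK// ge0_fin_numE. Qed.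
Let c_gt0 : 0 < c.
Proof.
rewrite -lte_fin -muF0; apply: mu_fundamental_domain_gt0 fF0.
by case: nG => /(_ 0) [].
Qed.
Let I01 : set R := `[0, 1[%classic.

Definition digit_measure (A : set (odo G)) : \bar R :=
  (c^-1%:E * (mu \x leb)%E (digit_odo @^-1` A `&` (F0 `*` I01)))%E.

Let mF0I : measurable (F0 `*` I01).
Proof. by apply: measurableX; [case: fF0|exact: measurable_itv]. Qed.

(** The interval [0, 1[ splits into [radix j] intervals of equal length on which the level-[j]
    digits are constant; the slices of [F0] over them are the tiles of a fundamental domain of
    [G j], moved back to [F0]. *)
Let digit_measure_box j U : quot_borel (G j) U ->
  (mu \x leb)%E (digit_odo @^-1` (@cyl R G j U) `&` (F0 `*` I01)) =
  ((radix j)%:R^-1%:E * mu (U `&` tiles F0 (radix j) (digit_rep j)))%E.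
Proof.
move=> qU; have [mU iU] := qU; have [mF0 _ _] := fF0.
have [M0 ML Mc Mu] := digit_reps j.
have inj_rep i k : (i < radix j)%N -> (k < radix j)%N ->
    digit_rep j i = digit_rep j k -> i = k.
  by move=> iN kN E; apply: Mu => //; rewrite E mulVh; exact: subg1.
have M0' : 0 < (radix j)%:R :> R by rewrite ltr0n.
rewrite (mu_tiles (sG 0) fF0)//.
pose I i : set R := `[i%:R / (radix j)%:R, i.+1%:R / (radix j)%:R[%classic.
pose B i := (F0 `&` (fun g => g ** digit_rep j i) @^-1` U) `*` I i.
have mFU i : measurable (F0 `&` (fun g => g ** digit_rep j i) @^-1` U).
  apply: measurableI => //; exact: (measurable_preim (measurable_hmulr _) mU).
have mB i : measurable (B i) by apply: measurableX => //; exact: measurable_itv.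
have IE i u : I i u -> Num.truncn (u * (radix j)%:R) = i.
  rewrite /I /= in_itv /= ler_pdivrMr// ltr_pdivlMr// => ?; exact: truncn_def.
have -> : digit_odo @^-1` (@cyl R G j U) `&` (F0 `*` I01) =
    \big[setU/set0]_(i < radix j) B i.
  rewrite -bigcup_mkord digit_odo_cyl//; apply/seteqP; split.
    move=> [g u] /= [Ug [/= Fg]]; rewrite /I01 /= in_itv /= => /andP[u0 u1].
    have uM : 0 <= u * (radix j)%:R by rewrite mulr_ge0// ltW.
    exists (Num.truncn (u * (radix j)%:R)) => /=.
      by rewrite truncn_lt_nat// gtr_pMl.
    split => //=; rewrite /I /= in_itv /= ler_pdivrMr// ltr_pdivlMr//.
    exact: truncn_itv.
  move=> [g u] [i /= iM [/= [Fg Ug] Iu]]; rewrite (IE _ _ Iu); split => //; split => //=.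
  move: Iu; rewrite /I /I01 /= !in_itv /= => /andP[u0 u1].
  rewrite (le_trans _ u0) ?divr_ge0// (lt_le_trans u1)//.
  by rewrite ler_pdivrMr// mul1r ler_nat.
rewrite (@measure_semi_additive_ord_I _ _ _ (mu \x leb)%E B); last 3 first.
- by move=> k _.
- apply/trivIsetP => i k _ _ ik; rewrite -subset0 => -[g u] [[_ /= /IE i1] [_ /= /IE k1]].
  by move/eqP: ik; apply; rewrite -i1 -k1.
- exact: bigsetU_measurable.
rewrite ge0_sume_distrr; last by move=> i _; exact: measure_ge0.
apply: eq_bigr => i _.
transitivity (mu (F0 `&` (fun g => g ** digit_rep j i) @^-1` U) * leb (I i))%E.
  by apply: product_measure1E => //; exact: measurable_itv.
rewrite muleC; congr (_ * _)%E.
rewrite leb_itvco ltr_pM2r ?invr_gt0// ltr_nat ltnSn -mulrBl.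
by rewrite -natrB// subSnn mul1r.
Qed.

Lemma odo_measure_digit : odo_measure digit_measure.
Proof.
split.
- by rewrite /digit_measure preimage_set0 set0I measure0 mule0.
- move=> A _; apply: mule_ge0; last exact: measure_ge0.
  by rewrite lee_fin invr_ge0 ltW.
- move=> F mF tF; rewrite /digit_measure preimage_bigcup setI_bigcupl.
  have mF' n : measurable (digit_odo @^-1` F n `&` (F0 `*` I01)).
    by apply: measurableI => //; exact: measurable_digit_odo.
  rewrite measure_semi_bigcup//.
  + by rewrite nneseriesZl// => n _; exact: measure_ge0.
  + apply/trivIsetP => i k _ _ ik; rewrite -subset0 => p [[Fi _] [Fk _]].
    have /trivIsetP /(_ i k I I ik) := tF.
    by rewrite -subset0; apply; split; [exact: Fi|exact: Fk].
  + exact: bigcup_measurable.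
- move=> j U F qU fF Ffin; rewrite -/(mu F) -/(mu (U `&` F)).
  have [M0 ML Mc Mu] := digit_reps j.
  have dGj : discrete_subgroup (G j) by case: nG => /(_ j) [].
  have G0 : G j `<=` G 0 by exact: nested_le.
  have fT := tiles_fundamental_domain (sG 0) (sG j) G0 fF0 (digit_reps j).
  have cj := countable_discrete dGj.
  rewrite /digit_measure digit_measure_box//.
  have FE : mu F = ((radix j)%:R * c)%:E.
    have := mu_index (sG 0) dGj G0 (digit_reps j) fF0 fF (quot_borelT _).
    by rewrite !setTI muF0 -EFinM.
  rewrite (mu_fundamental_domain_eq (sG j) cj fF fT qU) FE.
  rewrite muleCA muleA muleC muleA -!EFinM (_ : _ * _ = 1) ?mul1e//.
  by field; rewrite lt0r_neq0// lt0r_neq0// ltr0n.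
Qed.

End Digits.

Lemma ex_odo_measure (G : nat -> set (H3 R)) : nested_lattices G ->
  exists m, @odo_measure R G m.
Proof.
move=> nG; have [lG GS] := nG.
have [_ [F0 fF0 F0fin]] := lG 0.
have /choice[Nr repsNr] : forall j, exists p : nat * (nat -> H3 R),
    coset_reps (G j) (G j.+1) p.1 p.2.
  by move=> j; have [N [r cr]] := ex_coset_reps (lG j) (lG j.+1) (GS j); exists (N, r).
by exists (digit_measure nG repsNr F0); exact: odo_measure_digit.
Qed.

End OdometerMeasure.

(** * Odometers of cofinal sequences *)

Section Cofinal.
Variable R : realType.
Implicit Types (g h : H3 R) (L U F : set (H3 R)).
Local Notation mu := (@mu R).

Lemma odo_meas_sigma_algebra (G : nat -> set (H3 R)) :
  sigma_algebra setT (@odo_meas R G).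
Proof. exact: smallest_sigma_algebra. Qed.

Lemma odo_meas_preimage (G L : nat -> set (H3 R)) (f : odo G -> odo L) :
  (forall j U, quot_borel (L j) U -> odo_meas (f @^-1` @cyl R L j U)) ->
  forall B, odo_meas B -> odo_meas (f @^-1` B).
Proof.
move=> fcyl B; apply: (odo_meas_induction (P := fun B => odo_meas (f @^-1` B))) => //.
have [G0 GC GU] := odo_meas_sigma_algebra G; split.
- by rewrite preimage_set0.
- by move=> A mA; rewrite setTD preimage_setC -setTD; exact: GC.
- by move=> A mA; rewrite preimage_bigcup; exact: GU.
Qed.

Section Transfer.
Variables (G L : nat -> set (H3 R)) (nG : nested_lattices G).
Variables (nL : nested_lattices L) (k : nat -> nat).
Hypothesis kL : forall j, G (k j) `<=` L j.

Let sG j : subgroup (G j). Proof. by apply: lattice_subgroup; case: nG. Qed.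
Let sL j : subgroup (L j). Proof. by apply: lattice_subgroup; case: nL. Qed.

(** A coset of [G (k j)] lies in exactly one coset of [L j]; the union produces that coset without
    choosing a representative. *)
Definition saturate (x : odo G) (j : nat) : set (H3 R) :=
  \bigcup_(g in proj1_sig x (k j)) lcoset (L j) g.

Lemma saturateE x j g : proj1_sig x (k j) g -> saturate x j = lcoset (L j) g.
Proof.
have [g0 xE] := odo_coset x (k j); rewrite /saturate xE => xg.
apply/seteqP; split => [y [h gh hy]|y gy]; last by exists g.
have E : lcoset (L j) g0 = lcoset (L j) h.
  by apply: lcoset_eq => //; apply/lcosetP/kL/lcosetP.
have <- : lcoset (L j) g0 = lcoset (L j) g.
  by apply: lcoset_eq => //; apply/lcosetP/kL/lcosetP.
by rewrite E.
Qed.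

Lemma odo_inhabited (x : odo G) j : exists g, proj1_sig x j g.
Proof. by have [g ->] := odo_coset x j; exists g; exact: lcoset_refl. Qed.

Lemma saturate_inv_lim x : inv_lim L (saturate x).
Proof.
split=> j.
  by have [g xg] := odo_inhabited x (k j); exists g; exact: saturateE.
(* [k] may fail to be monotone, so the representative is taken at a level past both indices. *)
have [g xg] := odo_inhabited x (maxn (k j) (k j.+1)).
have x1 : proj1_sig x (k j) g by apply: odo_le xg; exact: leq_maxl.
have x2 : proj1_sig x (k j.+1) g by apply: odo_le xg; exact: leq_maxr.
rewrite (saturateE x1) (saturateE x2).
by move=> y /lcosetP Lgy; apply/lcosetP; case: nL => _; apply.
Qed.

Definition odo_map (x : odo G) : odo L := exist _ (saturate x) (saturate_inv_lim x).

Lemma odo_map_cyl j U : quot_borel (L j) U ->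
  odo_map @^-1` @cyl R L j U = @cyl R G (k j) U.
Proof.
move=> [_ iU]; apply/seteqP; split => x; rewrite /cyl /=;
  have [g xg] := odo_inhabited x (k j); rewrite (saturateE xg) lcoset_subset//.
- have [g0 xE] := odo_coset x (k j); rewrite xE => Ug.
  apply/lcoset_subset => //; first by move=> ? ? ? /kL; exact: iU.
  move: xg; rewrite xE => /lcosetP/kL/(subgV (sL j)).
  rewrite hinvM hinvK => /iU - /(_ _ Ug).
  by rewrite mulVKh.
- exact.
Qed.

Lemma quot_borel_sub j U : quot_borel (L j) U -> quot_borel (G (k j)) U.
Proof. by move=> [mU iU]; split => // g gam Ug /kL; exact: iU. Qed.

Lemma odo_map_act h x : odo_map (odo_act h x) = odo_act h (odo_map x).
Proof.
apply: odo_eq => j /=; have [g xg] := odo_inhabited x (k j).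
rewrite (saturateE xg) (@saturateE _ _ (h ** g)); last by exists g.
apply/seteqP; split=> y.
- move=> [gam Lg <-]; exists (g ** gam); first by exists gam.
  by rewrite hmulA.
- by move=> [_ [gam Lg <-] <-]; exists gam => //; rewrite hmulA.
Qed.

Lemma odo_measure_map m : @odo_measure R G m ->
  @odo_measure R L (fun B => m (odo_map @^-1` B)).
Proof.
move=> [m0 m_ge0 mU mcyl].
have mmap B : odo_meas B -> odo_meas (odo_map @^-1` B).
  apply: odo_meas_preimage => j U qU; rewrite odo_map_cyl//.
  by apply: odo_meas_cyl; exact: quot_borel_sub.
split.
- by rewrite preimage_set0.
- by move=> A /mmap; exact: m_ge0.
- move=> F mF tF; rewrite preimage_bigcup mU//.
  + by move=> n; exact: mmap.
  + apply/trivIsetP => i j _ _ ij; rewrite -subset0 => x [Fi Fj].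
    have /trivIsetP /(_ i j I I ij) := tF.
    by rewrite -subset0; apply; split; [exact: Fi|exact: Fj].
- move=> j U F qU fF Ffin; rewrite odo_map_cyl//.
  have [lGk [FG fG FGfin]] : lattice (G (k j)) by case: nG.
  have lL : lattice (L j) by case: nL.
  have := mcyl _ _ _ (quot_borel_sub qU) fG FGfin.
  rewrite -/(mu F) -/(mu (U `&` F)) -/(mu FG) -/(mu (U `&` FG)) in Ffin FGfin *.
  have FG0 := mu_fundamental_domain_gt0 lGk fG.
  have lG : lattice (G (k j)) by case: nG.
  have := mu_ratio lL lG (kL (j := j)) fF fG qU.
  have FGE : mu FG = (fine (mu FG))%:E by rewrite fineK// ge0_fin_numE.
  rewrite FGE in FG0 *; set c := fine (mu FG) in FG0 * => E1 E2.
  have cN0 : c != 0 by rewrite gt_eqF// -lte_fin.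
  have cancel x : (x * c%:E * c^-1%:E = x)%E.
    by rewrite -muleA -EFinM mulfV// mule1.
  by rewrite -(cancel (m _)) E2 muleAC E1 cancel.
Qed.

End Transfer.

Lemma odo_map_cancel (G L : nat -> set (H3 R)) (nG : nested_lattices G)
    (nL : nested_lattices L) (k k' : nat -> nat)
    (kL : forall j, G (k j) `<=` L j) (kG : forall j, L (k' j) `<=` G j) x :
  odo_map nL nG kG (odo_map nG nL kL x) = x.
Proof.
apply: odo_eq => i /=; have [g xg] := odo_inhabited nG x (maxn (k (k' i)) i).
have xk : proj1_sig x (k (k' i)) g by apply: odo_le xg; exact: leq_maxl.
have xi : proj1_sig x i g by apply: odo_le xg; exact: leq_maxr.
have sG j : subgroup (G j) by apply: lattice_subgroup; case: nG.
have sL j : subgroup (L j) by apply: lattice_subgroup; case: nL.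
have E : proj1_sig (odo_map nG nL kL x) (k' i) g.
  by rewrite /= (saturateE nL kL xk); exact: lcoset_refl.
rewrite (saturateE nG kG E).
by have [g0 xE] := odo_coset x i; rewrite xE in xi *; rewrite (lcoset_eq _ xi).
Qed.

(** The measure on [odo L] is chosen as the image of one on [odo G], so measure preservation holds
    by definition; the two transfer maps are inverse to each other everywhere, and all exceptional
    sets are empty. *)
Lemma cofinal_odo_iso (G L : nat -> set (H3 R)) (k k' : nat -> nat) :
  nested_lattices G -> nested_lattices L ->
  (forall j, G (k j) `<=` L j) -> (forall j, L (k' j) `<=` G j) -> odo_iso G L.
Proof.
move=> nG nL kL kG; have [m hm] := ex_odo_measure nG.
exists m, (fun B => m (odo_map nG nL kL @^-1` B)); split => //.
  exact: odo_measure_map.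
have [m0 _ _ _] := hm.
exists (odo_map nG nL kL), (odo_map nL nG kG); split.
- apply: odo_meas_preimage => j U qU; rewrite odo_map_cyl//.
  by apply: odo_meas_cyl; exact: (quot_borel_sub kL).
- apply: odo_meas_preimage => j U qU; rewrite odo_map_cyl//.
  by apply: odo_meas_cyl; exact: (quot_borel_sub kG).
- by [].
- have mO (H : nat -> set (H3 R)) : odo_meas (set0 : set (odo H)).
    by have [] := odo_meas_sigma_algebra H.
  split.
  + by exists set0 => // x _; exact: odo_map_cancel.
  + by exists set0; [rewrite preimage_set0|move=> x _; exact: odo_map_cancel].
  + by move=> h; exists set0 => // x _; exact: odo_map_act.
Qed.

End Cofinal.

(** * The invariants S and xi *)

Section Invariants.
Variable R : realType.
Implicit Types (g h a b : H3 R) (L : set (H3 R)) (G : nat -> set (H3 R)).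

Definition proj_sub L L' := forall g, L g -> exists2 h, L' h & g.1 = h.1.
Definition cen_sub L L' := forall t : R, L (cen t) -> L' (cen t).

Lemma proj_sub_trans L1 L2 L3 : proj_sub L1 L2 -> proj_sub L2 L3 -> proj_sub L1 L3.
Proof. by move=> H1 H2 g /H1[h /H2[k Lk hk] gh]; exists k; rewrite // gh. Qed.

Lemma sub_proj L L' : L `<=` L' -> proj_sub L L'.
Proof. by move=> LL' g /LL' Lg; exists g. Qed.

Definition pairing (v : 'cV[R]_2) g : R :=
  v ord0 ord0 * g.1.1 + v ord_max ord0 * g.1.2.

Lemma sum2_col (F : 'I_2 -> R) : \sum_(i < 2) F i = F ord0 + F ord_max.
Proof. by rewrite big_ord_recl big_ord1; congr (_ + F _); apply/val_inj. Qed.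

Lemma pairingE (v : 'cV[R]_2) g : pairing v g = (v^T *m pr g) ord0 ord0.
Proof. by rewrite mxE sum2_col !mxE. Qed.

(** Membership in the dual lattice becomes independent of the matrix [A]. Conversely the columns of
    [A] are the projections of a basis, and the integer vector consists of the values of [v] on that
    basis. *)
Lemma dual_projP L v : lattice L ->
  dual_proj L v <-> forall g, L g -> pairing v g \is a Num.int.
Proof.
move=> lL; have sL := lattice_subgroup lL; split.
- move=> [A [uA prL [n ->]]] g Lg.
  have [m _ gE] : [set A *m intcv R n | n in [set: 'cV[int]_2]] (pr g).
    by rewrite -prL; exists g.
  rewrite pairingE -gE trmx_mul trmx_inv trmxK mulmxA -(mulmxA _ (invmx A)).
  rewrite mulVmx// mulmx1 mxE; apply: rpred_sum => i _; rewrite !mxE.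
  by apply: rpredM; exact: intr_int.
move=> vL; have [a [b [xi bL]]] := lattice_has_basis lL.
have [[La Lb] d0 intL _ _] := bL.
pose A : 'M[R]_2 := \matrix_(i, j) (if j == ord0 then pr a i ord0 else pr b i ord0).
have A0 i : A i ord0 = pr a i ord0 by rewrite mxE.
have A1 i : A i ord_max = pr b i ord0 by rewrite mxE.
have detA : \det A = hdet a b.
  rewrite (expand_det_row _ ord0) sum2_col /cofactor !det_mx11 !mxE /=.
  by rewrite /hdet addn0 add0n expr0 expr1; ring.
have uA : A \in unitmx by rewrite unitmxE detA unitfE.
exists A; split => //.
- apply/seteqP; split.
  + move=> _ [g Lg <-]; have [/intrP[m mE] /intrP[n nE]] := intL _ Lg.
    exists (\col_i (if i == ord0 then m else n)) => //.
    have [g1 g2] := cramer g d0; rewrite mE nE in g1 g2.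
    apply/matrixP => i j; rewrite ord1 mxE sum2_col A0 A1 !mxE /=.
    by case: (i) => [[|[|//]] hi] /=; rewrite ?g1 ?g2; ring.
  + move=> _ [n _ <-].
    have [s Ls [s1 s2]] := subg_coords (n ord0 ord0) (n ord_max ord0) sL La Lb d0.
    have [g1 g2] := cramer s d0; rewrite s1 s2 in g1 g2.
    exists s => //; apply/matrixP => i j; rewrite ord1 [RHS]mxE sum2_col A0 A1 !mxE /=.
    by case: (i) => [[|[|//]] hi] /=; rewrite ?g1 ?g2; ring.
- have [/intrP[m mE] /intrP[n nE]] := (vL _ La, vL _ Lb).
  exists (\col_i (if i == ord0 then m else n)).
  apply: (canRL (mulKmx _)); first by rewrite unitmx_tr.
  apply/matrixP => i j; rewrite ord1 mxE sum2_col !mxE.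
  have [->|->] : i = ord0 \/ i = ord_max.
    by case: i => [[|[|//]] hi]; [left|right]; exact: val_inj.
  + by rewrite /= -mE /pairing; ring.
  + by rewrite /= -nE /pairing; ring.
Qed.

Lemma S_ofP G v : nested_lattices G ->
  S_of G v <-> exists j, forall g, G j g -> pairing v g \is a Num.int.
Proof.
move=> [lG _]; split.
  by move=> [j _ /(dual_projP _ (lG j))]; exists j.
by move=> [j H]; exists j => //; apply/dual_projP.
Qed.

(** The group [xi^-1] Z is the dual of the centre [xi] Z. Like [S_of], this invariant is a union of
    dual groups and reverses inclusions. *)
Lemma xi_ofP G s : nested_lattices G ->
  xi_of G s <-> exists j, forall t, G j (cen t) -> s * t \is a Num.int.
Proof.
move=> [lG _]; split.
- move=> [j [xi [[xi0 cG] [m ->]]]]; exists j => t /cG[n ->].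
  rewrite (_ : _ / _ * _ = m%:~R * n%:~R); last by field; rewrite lt0r_neq0.
  by apply: rpredM; exact: intr_int.
- move=> [j H]; have [a [b [xi [_ _ _ xi0 cG]]]] := lattice_has_basis (lG j).
  exists j, xi; split.
    split=> // t; rewrite cG; split=> [/intrP[m mE]|[m ->]].
      by exists m; rewrite -mE divfK ?lt0r_neq0.
    by rewrite mulfK ?lt0r_neq0// intr_int.
  have /H/intrP[m mE] : G j (cen xi) by apply/cG; rewrite divff ?lt0r_neq0// int_num1.
  by exists m; rewrite -mE mulfK ?lt0r_neq0.
Qed.

Lemma S_of_mono G G' : nested_lattices G -> nested_lattices G' ->
  (forall j, exists k, proj_sub (G k) (G' j)) -> S_of G' `<=` S_of G.
Proof.
move=> nG nG' H v /(S_ofP _ nG')[j vj]; apply/S_ofP => //.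
have [k Hk] := H j; exists k => g /Hk[h Gh gh].
by rewrite /pairing gh; exact: vj.
Qed.

Lemma xi_of_mono G G' : nested_lattices G -> nested_lattices G' ->
  (forall j, exists k, cen_sub (G k) (G' j)) -> xi_of G' `<=` xi_of G.
Proof.
move=> nG nG' H s /(xi_ofP _ nG')[j sj]; apply/xi_ofP => //.
by have [k Hk] := H j; exists k => t /Hk; exact: sj.
Qed.

(** The dual of [p(G' j)] is generated by two vectors [va] and [vb], whose pairings are the Cramer
    coordinates in a basis. Each is integral on some level of [G], hence both are on the deeper of
    the two levels, whose projections then have integral coordinates. *)
Lemma S_of_proj_sub G G' : nested_lattices G -> nested_lattices G' ->
  S_of G' `<=` S_of G -> forall j, exists k, proj_sub (G k) (G' j).
Proof.
move=> nG nG' SS j; have [lG' _] := nG'.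
have sG' := lattice_subgroup (lG' j).
have [a [b [xi [[La Lb] d0 intL xi0 cL]]]] := lattice_has_basis (lG' j).
pose v (x y : R) : 'cV[R]_2 := \col_i (if i == ord0 then x else y).
have vE x y g : pairing (v x y) g = x * g.1.1 + y * g.1.2.
  by rewrite /pairing !mxE.
pose va := v (b.1.2 / hdet a b) (- b.1.1 / hdet a b).
pose vb := v (- a.1.2 / hdet a b) (a.1.1 / hdet a b).
have vaE g : pairing va g = hdet g b / hdet a b.
  by rewrite vE {3}/hdet; field.
have vbE g : pairing vb g = hdet a g / hdet a b.
  by rewrite vE {3}/hdet; field.
have /SS/(S_ofP _ nG)[k1 H1] : S_of G' va.
  by apply/S_ofP => //; exists j => g /intL[]; rewrite vaE.
have /SS/(S_ofP _ nG)[k2 H2] : S_of G' vb.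
  by apply/S_ofP => //; exists j => g /intL[]; rewrite vbE.
exists (maxn k1 k2) => g Gg.
have /H1 : G k1 g by apply: nested_le Gg => //; exact: leq_maxl.
have /H2 : G k2 g by apply: nested_le Gg => //; exact: leq_maxr.
rewrite vaE vbE => /intrP[n nE] /intrP[m mE].
have [s Ls [s1 s2]] := subg_coords m n sG' La Lb d0.
exists s => //; have [g1 g2] := cramer g d0; have [h1 h2] := cramer s d0.
by rewrite (surjective_pairing g.1) (surjective_pairing s.1) g1 g2 h1 h2 mE nE s1 s2.
Qed.

Lemma xi_of_cen_sub G G' : nested_lattices G -> nested_lattices G' ->
  xi_of G' `<=` xi_of G -> forall j, exists k, cen_sub (G k) (G' j).
Proof.
move=> nG nG' XX j; have [lG' _] := nG'.
have [a [b [xi [_ _ _ xi0 cL]]]] := lattice_has_basis (lG' j).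
have /XX/(xi_ofP _ nG)[k H] : xi_of G' xi^-1.
  by apply/xi_ofP => //; exists j => t /cL; rewrite mulrC.
by exists k => t /H; rewrite mulrC => /cL.
Qed.

Lemma hinv_hdet g h : hdet (hinv g) h = - hdet g h.
Proof. by rewrite /hdet /=; ring. Qed.

Lemma conjgE g h : g ** h ** hinv g = cen (hdet g h) ** h.
Proof. by rewrite (commE g h) !hmulA mulhK. Qed.

(** The elements of [L] that conjugation by [g] sends into [L'] form a subgroup containing [a], [b]
    and the central part, and these generate [L]. *)
Lemma conj_subset L L' a b xi g : subgroup L -> subgroup L' ->
  lattice_basis L a b xi -> cen_sub L L' ->
  L' (g ** a ** hinv g) -> L' (g ** b ** hinv g) ->
  forall lam, L lam -> L' (g ** lam ** hinv g).
Proof.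
move=> sL sL' [[La Lb] d0 intL xi0 cL] cLL' La' Lb' lam Llam.
pose K := [set x | L x /\ L' (g ** x ** hinv g)].
have sK : subgroup K.
  split; first by split; [exact: subg1|rewrite mulh1 mulhV; exact: subg1].
  - move=> x y [Lx Lx'] [Ly Ly']; split; first exact: subgM.
    rewrite (_ : _ ** hinv g = (g ** x ** hinv g) ** (g ** y ** hinv g)).
      exact: subgM.
    by rewrite -!hmulA mulKh.
  - move=> x [Lx Lx']; split; first exact: subgV.
    rewrite (_ : _ ** hinv g = hinv (g ** x ** hinv g)); first exact: subgV.
    by rewrite !hinvM hinvK hmulA.
have [/intrP[m mE] /intrP[n nE]] := intL _ Llam.
have [s [Ls Ls'] [s1 s2]] := subg_coords m n sK (conj La La') (conj Lb Lb') d0.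
have cE : hinv s ** lam = cen (hinv s ** lam).2.
  apply: (hdet0_cen d0).
    by rewrite hdetMl hinv_hdet mulrDl mulNr s1 mE addNr.
  rewrite hdetMr (_ : hdet a (hinv s) = - hdet a s); last by rewrite /hdet /=; ring.
  by rewrite mulrDl mulNr s2 nE addNr.
have Kc : K (hinv s ** lam).
  have Lc : L (hinv s ** lam) by apply: subgM => //; exact: subgV.
  split => //; rewrite cE -cenC mulhK; apply: cLL'; rewrite -cE//.
by have [] : K lam by rewrite -(mulVKh s lam); exact: subgM.
Qed.

(** Conjugation by [g] multiplies [h] by [cen (hdet g h)], which is linear in [p(g)]. Carrying a
    basis to elements of [L'] with the same projections is therefore a system of two linear
    equations with determinant nonzero. *)
Lemma conjugate_of_invariants L L' : lattice L -> lattice L' ->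
  proj_sub L L' -> proj_sub L' L -> cen_sub L L' -> cen_sub L' L -> conjugate L L'.
Proof.
move=> lL lL' pLL' pL'L cLL' cL'L.
have sL := lattice_subgroup lL; have sL' := lattice_subgroup lL'.
have [a [b [xi bL]]] := lattice_has_basis lL.
have [[La Lb] d0 intL xi0 cL] := bL.
have [a' La' aE] := pLL' _ La; have [b' Lb' bE] := pLL' _ Lb.
have bL' : lattice_basis L' a' b' xi.
  have dE : hdet a' b' = hdet a b by rewrite /hdet aE bE.
  split => //; first by rewrite dE.
  - move=> g /pL'L[h Lh gh]; have := intL _ Lh; rewrite dE.
    have -> : hdet g b' = hdet h b by rewrite /hdet gh bE.
    by have -> : hdet a' g = hdet a h by rewrite /hdet gh aE.
  - by move=> t; rewrite -cL; split; [exact: cL'L|exact: cLL'].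
(* The solution of [hdet g a = a'.2 - a.2] and [hdet g b = b'.2 - b.2], in coordinates with respect
   to [p(a)] and [p(b)]. *)
pose al := (b'.2 - b.2) / hdet a b; pose be := (a.2 - a'.2) / hdet a b.
pose g : H3 R := (al * a.1.1 + be * b.1.1, al * a.1.2 + be * b.1.2, 0).
have ga : hdet g a = a'.2 - a.2.
  have -> : hdet g a = - (be * hdet a b) by rewrite /hdet /=; ring.
  by rewrite /be divfK//; ring.
have gb : hdet g b = b'.2 - b.2.
  have -> : hdet g b = al * hdet a b by rewrite /hdet /=; ring.
  by rewrite /al divfK.
have shift u u' s : u.1 = u'.1 -> s = u'.2 - u.2 -> cen s ** u = u'.
  case: u => [[x y] z]; case: u' => [[x' y'] z'] /= [-> ->] ->.
  by rewrite /hmul /cen /=; congr (_, _, _); ring.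
have gaE : g ** a ** hinv g = a' by rewrite conjgE; exact: shift.
have gbE : g ** b ** hinv g = b' by rewrite conjgE; exact: shift.
exists g; apply/seteqP; split => [lam' Llam'|_ [lam Llam <-]].
- exists (hinv g ** lam' ** hinv (hinv g)); last first.
    by rewrite hinvK !hmulA mulhV mul1h mulhK.
  apply: (conj_subset sL' sL bL') => //.
  + by rewrite -gaE hinvK !hmulA mulVh mul1h mulhVK.
  + by rewrite -gbE hinvK !hmulA mulVh mul1h mulhVK.
- by apply: (conj_subset sL sL' bL) => //; rewrite ?gaE ?gbE.
Qed.

Lemma conjugate_sub L L' : lattice L -> conjugate L L' ->
  proj_sub L L' /\ proj_sub L' L /\ cen_sub L L' /\ cen_sub L' L.
Proof.
move=> lL [g ->]; have p1 h : (g ** h ** hinv g).1 = h.1.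
  by rewrite conjgE; case: h => [[x y] z]; rewrite /= !add0r.
split; [|split; [|split]].
- by move=> h Lh; exists (g ** h ** hinv g) => //; exists h.
- by move=> _ [h Lh <-]; exists h.
- by move=> t Lt; exists (cen t) => //; rewrite -cenC mulhK.
- move=> t [h Lh /(congr1 (fun x => hinv g ** x ** g))].
  by rewrite -!hmulA mulKh mulVh mulh1 cenC mulKh => <-.
Qed.

(** * Interleaving two sequences with the same invariants *)

Section Interleave.
Variables (G G' : nat -> set (H3 R)).
Hypotheses (nG : nested_lattices G) (nG' : nested_lattices G').

(** [L j] lies between [G (n j.+1)] and [G (n j)], and [L' j] between [G' (m j.+1)] and [G' (m j)]:
    this gives both the lattice property and cofinality. The hypotheses alternate so that each group
    can borrow from the other sequence without leaving its own sandwich. *)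
Lemma interleave_conjugate (n m : nat -> nat) :
  (forall j, (j <= n j)%N) -> (forall j, (j <= m j)%N) ->
  (forall j, (n j <= n j.+1)%N) -> (forall j, (m j <= m j.+1)%N) ->
  (forall j, proj_sub (G' (m j)) (G (n j)) /\ cen_sub (G' (m j)) (G (n j))) ->
  (forall j, proj_sub (G (n j.+1)) (G' (m j)) /\ cen_sub (G (n j.+1)) (G' (m j))) ->
  f_isomorphic G G'.
Proof.
move=> jn jm nn mm H1 H2.
have lG j : lattice (G j) by case: nG.
have lG' j : lattice (G' j) by case: nG'.
have sG j := lattice_subgroup (lG j).
have sG' j := lattice_subgroup (lG' j).
pose L j := [set x | exists gam t, [/\ G (n j.+1) gam, G' (m j) (cen t) &
  x = cen t ** gam] ].
pose L' j := [set x | G' (m j) x /\ exists2 gam, G (n j.+1) gam & x.1 = gam.1].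
have GL j : G (n j.+1) `<=` L j.
  move=> g Gg; exists g, 0; split => //; first exact: subg_cen0.
  by rewrite [cen 0](_ : _ = hone R) ?mul1h.
have LG j : L j `<=` G (n j).
  move=> _ [gam [t [Gg Gt ->]]]; apply: subgM => //.
    by apply: (H1 j).2.
  exact: (nested_le nG (nn j)).
have sL j : subgroup (L j).
  split.
  - by apply: (@GL j); exact: subg1.
  - move=> _ _ [x [s [Gx Gs ->]]] [y [t [Gy Gt ->]]].
    exists (x ** y), (s + t); split; [exact: subgM|by rewrite cenD; exact: subgM|].
    by rewrite cenD -!hmulA (hmulA x) -cenC -hmulA.
  - move=> _ [x [s [Gx Gs ->]]]; exists (hinv x), (- s).
    by rewrite cenN; split; [exact: subgV|exact: subgV|rewrite hinvM -cenN cenC].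
have GL' j : G' (m j.+1) `<=` L' j.
  move=> g Gg; split; first exact: (nested_le nG' (mm j)).
  exact: (H1 j.+1).1.
have LG' j : L' j `<=` G' (m j) by move=> g [].
have sL' j : subgroup (L' j).
  split.
  - by split; [exact: subg1|exists (hone R) => //; exact: subg1].
  - move=> x y [Gx [u Gu xu]] [Gy [v Gv yv]]; split; first exact: subgM.
    by exists (u ** v); [exact: subgM|rewrite /= xu yv].
  - move=> x [Gx [u Gu xu]]; split; first exact: subgV.
    by exists (hinv u); [exact: subgV|rewrite /= xu].
have lL j : lattice (L j) := lattice_between (lG _) (lG _) (sL j) (@GL j) (@LG j).
have lL' j : lattice (L' j) :=
  lattice_between (lG' _) (lG' _) (sL' j) (@GL' j) (@LG' j).
have nL : nested_lattices L.
  split => // j _ [gam [t [Gg Gt ->]]]; exists gam, t; split => //.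
    exact: (nested_le nG (nn j.+1)).
  exact: (nested_le nG' (mm j)).
have nL' : nested_lattices L'.
  split => // j g [Gg [gam Ggam gE]]; split; first exact: (nested_le nG' (mm j)).
  by exists gam => //; exact: (nested_le nG (nn j.+1)).
exists L, L'; split => //.
- move=> j; apply: conjugate_of_invariants => //.
  + move=> _ [gam [t [Gg Gt ->]]]; have [h Gh gh] := (H2 j).1 _ Gg.
    exists h; first by split => //; exists gam.
    by rewrite -gh; case: (gam) => [[x y] z]; rewrite /= !add0r.
  + by move=> g [Gg [gam Ggam gE]]; exists gam => //; exact: GL.
  + move=> t [gam [s [Gg Gs tE]]].
    have gE : gam = cen (t - s) by rewrite addrC cenD tE cenN mulKh.
    split; last by exists (hone R) => //; exact: subg1.
    rewrite tE; apply: subgM => //; rewrite gE; apply: (H2 j).2.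
    by rewrite -gE.
  + move=> t [Gt _]; exists (hone R), t; split => //; first exact: subg1.
    by rewrite mulh1.
- apply: (@cofinal_odo_iso _ G L (fun j => n j.+1) id) => // j.
  by move=> g /LG; exact: (nested_le nG (jn j)).
- apply: (@cofinal_odo_iso _ G' L' (fun j => m j.+1) id) => // j.
  by move=> g /LG'; exact: (nested_le nG' (jm j)).
Qed.

Lemma f_isomorphic_of_invariants :
  S_of G = S_of G' -> xi_of G = xi_of G' -> f_isomorphic G G'.
Proof.
have cof (H H' : nat -> set (H3 R)) : nested_lattices H -> nested_lattices H' ->
    S_of H' `<=` S_of H -> xi_of H' `<=` xi_of H -> exists f : nat -> nat, forall j,
    [/\ (j < f j)%N, proj_sub (H (f j)) (H' j) & cen_sub (H (f j)) (H' j)].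
  move=> nH nH' SS XX.
  suff /choice[f fP] : forall j, exists k,
    [/\ (j < k)%N, proj_sub (H k) (H' j) & cen_sub (H k) (H' j)] by exists f.
  move=> j.
  have [k1 H1] := S_of_proj_sub nH nH' SS j.
  have [k2 H2] := xi_of_cen_sub nH nH' XX j.
  exists (maxn j.+1 (maxn k1 k2)); split; first exact: leq_maxl.
    apply: proj_sub_trans H1; apply: sub_proj; apply: (nested_le nH).
    by rewrite !leq_max leqnn !orbT.
  move=> t Ht; apply: H2; apply: (nested_le nH) Ht.
  by rewrite !leq_max leqnn !orbT.
move=> SE XE.
have [f fP] : exists f : nat -> nat, forall j,
    [/\ (j < f j)%N, proj_sub (G (f j)) (G' j) & cen_sub (G (f j)) (G' j)].
  by apply: cof => //; rewrite ?SE ?XE.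
have [f' fP'] : exists f : nat -> nat, forall j,
    [/\ (j < f j)%N, proj_sub (G' (f j)) (G j) & cen_sub (G' (f j)) (G j)].
  by apply: cof => //; rewrite ?SE ?XE.
(* The two moduli are applied alternately; their strictness makes both index sequences unbounded. *)
pose n j := iter j (f \o f') 0%N; pose m j := f' (n j).
have nS j : n j.+1 = f (m j) by [].
have nlt j : (n j < n j.+1)%N.
  by rewrite nS; have [h1 _ _] := fP (m j); have [h2 _ _] := fP' (n j); exact: ltn_trans h2 h1.
have jn j : (j <= n j)%N by elim: j => // j IH; exact: leq_ltn_trans (nlt j).
apply: (@interleave_conjugate n m) => // j.
- by have [h _ _] := fP' (n j); exact: leq_trans (jn j) (ltnW h).
- exact: ltnW.
- have [h1 _ _] := fP (m j); have [h2 _ _] := fP' (n j.+1).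
  exact: leq_trans (ltnW h1) (ltnW h2).
- by have [] := fP' (n j).
- by rewrite nS; have [] := fP (m j).
Qed.

End Interleave.
End Invariants.

(** * Approximation by cylinders and invariance *)

Section PackedMeasure.
Variables (R : realType) (G : nat -> set (H3 R)).

(** The base point is a parameter because the inverse limit of an arbitrary sequence of sets can be
    empty. *)
Definition pointed_odo (x0 : odo G) : Type := odo G.

Variables (x0 : odo G).
HB.instance Definition _ := gen_eqMixin (pointed_odo x0).
HB.instance Definition _ := gen_choiceMixin (pointed_odo x0).
HB.instance Definition _ := isPointed.Build (pointed_odo x0) x0.

Definition odo_space := g_sigma_algebraType (@odo_gen R G : set (set (pointed_odo x0))).
HB.instance Definition _ := Measurable.on odo_space.

Variables (m : set (odo G) -> \bar R) (hm : odo_measure m).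

(* [m] is constrained on [odo_meas] only and may be negative elsewhere; the
   phantom proof argument lets the measure structure be inferred. *)
Definition packed_measure of odo_measure m := fun A : set odo_space =>
  if `[< odo_meas (A : set (odo G)) >] then m A else 0%E.

Let pE (A : set odo_space) : odo_meas (A : set (odo G)) -> packed_measure hm A = m A.
Proof. by move=> mA; rewrite /packed_measure asboolT. Qed.

Let p0 : packed_measure hm set0 = 0%E.
Proof. by rewrite /packed_measure; case: ifP => // _; case: hm. Qed.

Let p_ge0 A : (0 <= packed_measure hm A)%E.
Proof. by rewrite /packed_measure; case: asboolP => // mA; case: hm => _ + _ _; exact. Qed.

Let p_sigma_additive : semi_sigma_additive (packed_measure hm).
Proof.
move=> F mF tF mUF; have [_ _ mU _] := hm.
rewrite pE// mU// -(eq_eseriesr (fun n _ => pE (mF n))).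
by apply: is_cvg_nneseries => n _ _.
Qed.

HB.instance Definition _ := isMeasure.Build _ odo_space R (packed_measure hm)
  p0 p_ge0 p_sigma_additive.

End PackedMeasure.

Section OdometerProbability.
Variable R : realType.
Implicit Types (g h : H3 R) (U F : set (H3 R)) (G : nat -> set (H3 R)).
Local Notation mu := (@mu R).

Lemma odo_point G : nested_lattices G -> inv_lim G (fun j => lcoset (G j) (hone R)).
Proof.
move=> [lG nG]; split=> j; first by exists (hone R).
by move=> x /lcosetP Gx; apply/lcosetP; exact: nG.
Qed.

Lemma cyl_le G i j U : nested_lattices G -> (i <= j)%N -> quot_borel (G i) U ->
  @cyl R G i U = @cyl R G j U.
Proof.
move=> nG ij [mU iU]; apply/seteqP; split => x; rewrite /cyl /=.
  by move=> xU g xg; apply: xU; exact: odo_le xg.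
have sG k : subgroup (G k) by apply: lattice_subgroup; case: nG.
have [g xg] := odo_inhabited nG x j; have xig := odo_le ij xg.
move=> /(_ _ xg) Ug; have [g0 xE] := odo_coset x i.
move: xig; rewrite xE => /(lcoset_eq (sG i)) ->.
exact/lcoset_subset.
Qed.

Lemma quot_borel_nested G i j U : nested_lattices G -> (i <= j)%N ->
  quot_borel (G i) U -> quot_borel (G j) U.
Proof.
by move=> nG ij [mU iU]; split => // g gam Ug /(nested_le nG ij); exact: iU.
Qed.

Lemma quot_borelI (L U V : set (H3 R)) : quot_borel L U -> quot_borel L V -> quot_borel L (U `&` V).
Proof.
move=> [mU iU] [mV iV]; split; first exact: measurableI.
by move=> g gam [Ug Vg] Lg; split; [exact: iU|exact: iV].
Qed.

Lemma quot_borelC (L U : set (H3 R)) : subgroup L -> quot_borel L U -> quot_borel L (~` U).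
Proof.
move=> sL [mU iU]; split; first exact: measurableC.
move=> g gam Ug Lg Ugg; apply: Ug; rewrite -(mulhK g gam).
by apply: iU => //; exact: subgV.
Qed.

Lemma cylI G j U V : @cyl R G j U `&` @cyl R G j V = @cyl R G j (U `&` V).
Proof.
apply/seteqP; split=> x; rewrite /cyl /=.
  by move=> [xU xV] g xg; split; [exact: xU|exact: xV].
by move=> xUV; split => g /xUV [].
Qed.

Lemma cylC G j U : nested_lattices G -> quot_borel (G j) U ->
  ~` @cyl R G j U = @cyl R G j (~` U).
Proof.
move=> nG qU; have sG : subgroup (G j) by apply: lattice_subgroup; case: nG.
have [_ iU] := qU; have [_ iUc] := quot_borelC sG qU.
apply/seteqP; split=> x; rewrite /cyl /=; have [g ->] := odo_coset x j;
  by rewrite !lcoset_subset.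
Qed.

Lemma quot_borel_hmull (L U : set (H3 R)) h : quot_borel L U -> quot_borel L (hmul h @^-1` U).
Proof.
move=> [mU iU]; split; first exact: (measurable_preim (measurable_hmull _) mU).
by move=> g gam /= Ug Lg; rewrite hmulA; exact: iU.
Qed.

Lemma odo_act_cyl G j U h :
  @odo_act R G h @^-1` @cyl R G j U = @cyl R G j (hmul h @^-1` U).
Proof.
apply/seteqP; split=> x; rewrite /cyl /= => xU; first by move=> g xg; apply: xU; exists g.
by move=> _ [g xg <-]; exact: xU.
Qed.

Lemma odo_meas_act G h A : odo_meas A -> odo_meas (@odo_act R G h @^-1` A).
Proof.
apply: odo_meas_preimage => j U qU; rewrite odo_act_cyl.
by apply: odo_meas_cyl; exact: quot_borel_hmull.
Qed.

Lemma fundamental_domain_hmull (L F : set (H3 R)) h : fundamental_domain L F ->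
  fundamental_domain L (hmul h @^-1` F).
Proof.
move=> [mF cF uF]; split.
- exact: (measurable_preim (measurable_hmull _) mF).
- move=> g; have [f [gam [Ff Lg E]]] := cF (h ** g).
  exists (hinv h ** f), gam; rewrite /preimage /= mulVKh; split => //.
  by rewrite -hmulA -E mulKh.
- move=> f1 f2 g1 g2 F1 F2 L1 L2 E.
  have := uF _ _ _ _ F1 F2 L1 L2; rewrite -!hmulA E => /(_ erefl).
  by move=> /(congr1 (hmul (hinv h))); rewrite !mulKh.
Qed.

Section Probability.
Variables (G : nat -> set (H3 R)) (nG : nested_lattices G).
Variables (m : set (odo G) -> \bar R) (hm : odo_measure m).

Let lG j : lattice (G j). Proof. by case: nG. Qed.
Let sG j : subgroup (G j). Proof. exact: lattice_subgroup. Qed.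
Let x0 : odo G := exist _ _ (odo_point nG).
Let M : {measure set (odo_space x0) -> \bar R} := @packed_measure R G x0 m hm.

Let ME (A : set (odo G)) : odo_meas A -> M A = m A.
Proof. by move=> mA; rewrite /M /= /packed_measure asboolT. Qed.

Lemma odo_meas_setT H : odo_meas (setT : set (@odo R H)).
Proof.
have [H0 HC _] := odo_meas_sigma_algebra H.
by rewrite -(setD0 setT); exact: HC.
Qed.

Lemma odo_measC H (A : set (@odo R H)) : odo_meas A -> odo_meas (~` A).
Proof. by have [_ HC _] := odo_meas_sigma_algebra H; rewrite -setTD; exact: HC. Qed.

Lemma odo_measU H (A B : set (@odo R H)) : odo_meas A -> odo_meas B -> odo_meas (A `|` B).
Proof.
move=> mA mB; have [H0 _ HU] := odo_meas_sigma_algebra H.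
by rewrite -bigcup2E; apply: HU => -[|[|k]].
Qed.

Lemma odo_measI H (A B : set (@odo R H)) : odo_meas A -> odo_meas B -> odo_meas (A `&` B).
Proof.
move=> mA mB; rewrite -(setCK (A `&` B)) setCI; apply: odo_measC.
by apply: odo_measU; exact: odo_measC.
Qed.

Lemma odo_measD H (A B : set (@odo R H)) : odo_meas A -> odo_meas B -> odo_meas (A `\` B).
Proof. by move=> mA mB; rewrite setDE; apply: odo_measI => //; exact: odo_measC. Qed.

Lemma odo_measure_setT : m setT = 1%E.
Proof.
have [_ _ _ mcyl] := hm; have [dG [F fF Ffin]] := lG 0.
have := mcyl 0 setT F (quot_borelT _) fF Ffin; rewrite setTI -/(mu F).
have -> : @cyl R G 0 setT = setT by rewrite -subTset => x _ g.
have := mu_fundamental_domain_gt0 dG fF.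
have FE : mu F = (fine (mu F))%:E by rewrite fineK// ge0_fin_numE.
rewrite FE lte_fin => F0 /(congr1 (fun x => x * (fine (mu F))^-1%:E)%E).
by rewrite -muleA -EFinM mulfV ?lt0r_neq0// mule1.
Qed.

Lemma odo_measure_le1 A : odo_meas A -> (m A <= 1)%E.
Proof.
move=> mA; rewrite -odo_measure_setT -!ME//; last exact: odo_meas_setT.
by apply: le_measure; rewrite ?inE//; exact: odo_meas_setT.
Qed.

Definition odo_prob (A : set (odo G)) : R := fine (m A).

Lemma odo_probE A : odo_meas A -> m A = (odo_prob A)%:E.
Proof.
move=> mA; rewrite /odo_prob fineK// ge0_fin_numE; last by case: hm => _ + _ _; exact.
by rewrite (le_lt_trans (odo_measure_le1 mA))// ltry.
Qed.

Lemma odo_prob_sub A B C : odo_meas A -> odo_meas B -> odo_meas C ->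
  A `<=` B `|` C -> odo_prob A <= odo_prob B + odo_prob C.
Proof.
move=> mA mB mC ABC; rewrite -lee_fin EFinD -!odo_probE// -!ME//.
apply: (@le_trans _ _ (M (B `|` C))).
  by apply: le_measure; rewrite ?inE//; exact: odo_measU.
exact: measureU2.
Qed.

Lemma odo_prob0 : odo_prob set0 = 0.
Proof. by rewrite /odo_prob; case: hm => -> _ _ _. Qed.

Lemma odo_probT : odo_prob setT = 1.
Proof. by rewrite /odo_prob odo_measure_setT. Qed.

Lemma odo_prob_cyl j U F : quot_borel (G j) U -> fundamental_domain (G j) F ->
  (mu F < +oo)%E -> ((odo_prob (@cyl R G j U))%:E * mu F = mu (U `&` F))%E.
Proof.
move=> qU fF Ffin; have [_ _ _ mcyl] := hm.
by rewrite -odo_probE ?mcyl//; exact: odo_meas_cyl.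
Qed.

Lemma odo_gen_setI : setI_closed (@odo_gen R G).
Proof.
move=> _ _ [i [U [qU ->]]] [j [V [qV ->]]]; exists (maxn i j), (U `&` V).
have iM := leq_maxl i j; have jM := leq_maxr i j.
rewrite -cylI (cyl_le nG iM qU) (cyl_le nG jM qV); split=> //.
by apply: quot_borelI; [exact: quot_borel_nested qU|exact: quot_borel_nested qV].
Qed.

(** By uniqueness of measures it suffices to treat cylinders, which are stable under intersection.
    There, translating [U] amounts to translating the fundamental domain, and the level measure may
    be computed with any such domain. *)
Lemma odo_prob_act h A : odo_meas A -> odo_prob (@odo_act R G h @^-1` A) = odo_prob A.
Proof.
move=> mA; rewrite /odo_prob; congr fine.
pose f : odo_space x0 -> odo_space x0 := @odo_act R G h.
have mf : measurable_fun setT f.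
  by move=> _ B mB; rewrite setTI; exact: odo_meas_act.
pose fm : {mfun _ >-> _} := HB.pack f (isMeasurableFun.Build _ _ _ _ f mf).
rewrite -!ME//; last exact: odo_meas_act.
have gT : @odo_gen R G setT.
  exists 0, setT; split; first exact: quot_borelT.
  by apply/esym; rewrite -subTset => x _ g.
apply: (@measure_unique _ R (odo_space x0) (@odo_gen R G) (fun=> setT) erefl
  odo_gen_setI (fun=> gT) _ (pushforward M fm) M) => //.
- by rewrite -subTset => x _; exists 0%N.
- move=> _ [j [U [qU ->]]].
  have [dG [F fF Ffin]] := lG j.
  have mC := odo_meas_cyl qU.
  have qhU := quot_borel_hmull h qU.
  transitivity (M (@odo_act R G h @^-1` @cyl R G j U)) => //.
  rewrite odo_act_cyl !ME//; last exact: odo_meas_cyl.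
  rewrite !odo_probE//; last exact: odo_meas_cyl.
  have fhF := fundamental_domain_hmull (hinv h) fF.
  have hFE : mu (hmul (hinv h) @^-1` F) = mu F by apply: mu_hmull; case: fF.
  have E1 := odo_prob_cyl qhU fF Ffin.
  have := odo_prob_cyl qU fhF; rewrite hFE => /(_ Ffin) E2.
  have E3 : mu (hmul h @^-1` U `&` F) = mu (U `&` hmul (hinv h) @^-1` F).
    rewrite -(mu_hmull h (U := U `&` _)).
      by congr mu; apply/seteqP; split=> g [] /=; rewrite mulKh.
    by apply: measurableI; [case: qU|case: fhF].
  rewrite E3 -E2 in E1.
  have F0 := mu_fundamental_domain_gt0 dG fF.
  have FE : mu F = (fine (mu F))%:E by rewrite fineK// ge0_fin_numE.
  rewrite FE in E1 F0; rewrite lte_fin in F0.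
  by case: E1 => /(mulIf (lt0r_neq0 F0)) ->.
- move=> _; apply: (@le_lt_trans _ _ (M setT)); first by [].
  by rewrite ME ?odo_measure_setT ?ltry//; exact: odo_meas_setT.
Qed.

Definition cyl_approx (A : set (odo G)) := forall e, 0 < e -> exists j U,
  [/\ quot_borel (G j) U, odo_prob (A `\` @cyl R G j U) <= e &
      odo_prob (@cyl R G j U `\` A) <= e].

(** The approximable sets form a lambda-system containing the cylinders. For differences the two
    cylinders are brought to a common level; an increasing union is replaced by a stage that misses
    less than [e / 2]. *)
Lemma odo_prob_cyl_approx A : odo_meas A -> cyl_approx A.
Proof.
pose H : set (set (odo G)) := fun A => odo_meas A /\ cyl_approx A.
suff HH : @odo_meas R G `<=` H by move=> mA; have [] := HH _ mA.
clear A.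
apply: (lambda_system_subset odo_gen_setI) => //; last first.
  move=> _ [j [U [qU ->]]]; split; first exact: odo_meas_cyl.
  by move=> e e0; exists j, U; rewrite setDv odo_prob0; split => //; exact: ltW.
split => //.
- split; first exact: odo_meas_setT.
  move=> e e0; exists 0%N, setT.
  have -> : @cyl R G 0 setT = setT by rewrite -subTset => x _ g.
  by rewrite setDv odo_prob0; split; [exact: quot_borelT|exact: ltW|exact: ltW].
- move=> A B BA [mA aA] [mB aB]; split; first exact: odo_measD.
  move=> e e0; have e20 : 0 < e / 2 by rewrite divr_gt0.
  have [i [U [qU U1 U2]]] := aA _ e20; have [j [V [qV V1 V2]]] := aB _ e20.
  have iM := leq_maxl i j; have jM := leq_maxr i j.
  have mU := odo_meas_cyl qU; have mV := odo_meas_cyl qV.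
  have qVM := quot_borel_nested nG jM qV.
  have CE : @cyl R G (maxn i j) (U `&` ~` V) = @cyl R G i U `\` @cyl R G j V.
    by rewrite -cylI -(cyl_le nG iM qU) -cylC// -(cyl_le nG jM qV) setDE.
  exists (maxn i j), (U `&` ~` V); rewrite CE.
  split.
  + apply: quot_borelI; first exact: quot_borel_nested qU.
    exact: quot_borelC.
  + rewrite (splitr e) (le_trans _ (lerD U1 V2))//.
    apply: odo_prob_sub; [by apply: odo_measD; exact: odo_measD|exact: odo_measD|exact: odo_measD|].
    move=> x [[Ax nBx] nUV]; have [Ux|nUx] := pselect (@cyl R G i U x); last by left.
    right; split => //; apply: contrapT => nVx; exact: nUV.
  + rewrite (splitr e) (le_trans _ (lerD U2 V1))//.
    apply: odo_prob_sub; [by apply: odo_measD; exact: odo_measD|exact: odo_measD|exact: odo_measD|].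
    move=> x [[Ux nVx] nAB]; have [Ax|nAx] := pselect (A x); last by left.
    right; split => //; apply: contrapT => nBx; exact: nAB.
- move=> F ndF HF.
  have mF n : odo_meas (F n) by case: (HF n).
  have mUF : odo_meas (\bigcup_n F n).
    by have [_ _ HU] := odo_meas_sigma_algebra G; exact: HU.
  split=> // e e0; have e20 : 0 < e / 2 by rewrite divr_gt0.
  have mD n : odo_meas (\bigcup_n F n `\` F n) by exact: odo_measD.
  have cvgM : M \o (fun n => \bigcup_n F n `\` F n) @ \oo -->
      M (\bigcap_n (\bigcup_n F n `\` F n)).
    apply: nonincreasing_cvg_mu => //.
    - by rewrite ME// odo_probE// ltry.
    - by apply: bigcap_measurable => // n _; exact: mD.
    - move=> i j ij; apply/subsetPset => x [Ux nFj]; split => // Fi; apply: nFj.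
      by have /subsetPset := ndF _ _ ij; exact.
  have := cvgM.
  rewrite (_ : \bigcap_n _ = set0); last first.
    by rewrite -subset0 => x Hx; have [[k _ Fk] _] := Hx 0 I; have [_] := Hx k I; apply.
  rewrite measure0 => /fine_cvg /cvgr_lt /(_ _ e20) [n _ /(_ n (leqnn n))] /=.
  rewrite ME// -/(odo_prob _) => pn.
  have [_ aF] := HF n; have [j [U [qU U1 U2]]] := aF _ e20.
  have mU := odo_meas_cyl qU.
  exists j, U; split => //.
  + rewrite (splitr e) (le_trans _ (lerD (ltW pn) U1))//.
    apply: odo_prob_sub; [exact: odo_measD|exact: odo_measD|exact: odo_measD|].
    move=> x [Fx nU]; have [Fn|nFn] := pselect (F n x); first by right.
    by left.
  + rewrite (le_trans _ (le_trans U2 _))//; last by lra.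
    rewrite -[leRHS]addr0 -odo_prob0.
    apply: odo_prob_sub; [exact: odo_measD|exact: odo_measD| |].
      by have [] := odo_meas_sigma_algebra G.
    by move=> x [Ux nF]; left; split => // Fn; apply: nF; exists n.
Qed.

End Probability.
End OdometerProbability.

(** * Factor maps *)

Section Rotation.
Variable R : realType.
Implicit Types (g h a b lam : H3 R) (L U : set (H3 R)).

(** Steps shorter than 1/3 cannot jump over an interval of length 1/3. A fractional part above 2/3
    is a short step backwards, hence the negative multiples. *)
Lemma multiple_in_middle_third (theta : R) : theta \isn't a Num.int ->
  exists n m : int, 1 / 3 <= n%:~R * theta - m%:~R <= 2 / 3.
Proof.
move=> tN.
pose r := theta - (Num.floor theta)%:~R.
have := floor_itv theta; rewrite intrD => /andP[f1 f2].
have r1 : r < 1 by rewrite /r; lra.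
have r0 : 0 < r.
  rewrite lt0r /r subr_ge0 f1 andbT subr_eq0; apply: contraNneq tN => ->.
  exact: intr_int.
have small (s : R) : 0 < s -> s < 1 / 3 -> exists n : nat, 1 / 3 <= n%:R * s <= 2 / 3.
  move=> s0 s3; exists (Num.truncn ((1 / 3) / s)).+1.
  have q0 : 0 <= (1 / 3 : R) / s by rewrite divr_ge0// ltW.
  set t := Num.truncn _; have /andP[] := truncn_itv q0; rewrite -/t.
  rewrite ler_pdivlMr// ltr_pdivrMr// -(natr1 t) mulrDl mul1r => t1 t2.
  by apply/andP; split; lra.
have thetaE : theta = r + (Num.floor theta)%:~R by rewrite /r; ring.
case: (ltP r (1 / 3)) => r3.
  have [n nr] := small _ r0 r3.
  exists (Posz n), (Posz n * Num.floor theta); rewrite intrM -pmulrn.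
  by rewrite {1 3}thetaE (_ : _ - _ = n%:R * r)//; ring.
case: (leP r (2 / 3)) => r3'.
  exists 1, (Num.floor theta).
  by rewrite (_ : _ - _ = r) ?r3//; rewrite /r mul1r.
have [||n nr] := small (1 - r); [lra|lra|].
exists (- Posz n), (- Posz n * (Num.floor theta + 1)); rewrite intrM intrN intrD -pmulrn.
by rewrite {1 3}thetaE (_ : _ - _ = n%:R * (1 - r))//; ring.
Qed.

(* A function that descends to a circle-valued function on H_3(R)/L. *)
Definition circle_fun L (kappa : H3 R -> R) := measurable_fun setT kappa /\
  forall g lam, L lam -> kappa (g ** lam) - kappa g \is a Num.int.

(** An arc long enough for three rotations to cover the circle, and short enough to be moved off
    itself by any angle between 1/3 and 2/3. *)
Definition first_third (kappa : H3 R -> R) : set (H3 R) :=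
  [set g | kappa g - (Num.floor (kappa g))%:~R < 1 / 3].

Lemma measurable_frac : measurable_fun setT (fun x : R => x - (Num.floor x)%:~R).
Proof.
apply: measurable_funB => //.
have : {homo (fun x : R => (Num.floor x)%:~R : R) : x y / x <= y}.
  by move=> x y xy; rewrite ler_int le_floor.
exact: nondecreasing_measurable.
Qed.

Lemma first_third_quot_borel L kappa : circle_fun L kappa ->
  quot_borel L (first_third kappa).
Proof.
move=> [mk ik]; split.
  have mf : measurable_fun setT (fun g => kappa g - (Num.floor (kappa g))%:~R).
    exact: (measurableT_comp measurable_frac mk).
  rewrite (_ : first_third kappa = (fun g => kappa g - (Num.floor (kappa g))%:~R) @^-1`
    `]-oo, 1 / 3[%classic).
    by apply: (measurable_preim mf); exact: measurable_itv.
  by apply/seteqP; split=> g; rewrite /first_third /preimage /= in_itv.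
move=> g lam; rewrite /first_third /= => kg Llam.
have /intrP[n nE] := ik g _ Llam.
have -> : kappa (g ** lam) = kappa g + n%:~R by rewrite -nE; ring.
rewrite floorDrz ?intr_int// intrKfloor intrD; lra.
Qed.

Lemma first_third_disjoint kappa h theta (m : int) :
  (forall g, kappa (h ** g) = kappa g + theta) ->
  1 / 3 <= theta - m%:~R <= 2 / 3 ->
  forall g, first_third kappa g -> ~ first_third kappa (h ** g).
Proof.
move=> kh tm g; rewrite /first_third /= kh => k1 k2.
have /andP[f1 f2] := floor_itv (kappa g); rewrite intrD in f2.
have fE : Num.floor (kappa g + theta) = Num.floor (kappa g) + m.
  by apply: floor_def; rewrite !intrD; lra.
by move: k2; rewrite fE intrD; lra.
Qed.

Lemma first_third_cover kappa h :
  (forall g, kappa (h ** g) = kappa g + 1 / 3) -> forall g,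
  [\/ first_third kappa g, first_third kappa (h ** g) |
      first_third kappa (h ** (h ** g))].
Proof.
move=> kh g; have /andP[f1 f2] := floor_itv (kappa g); rewrite intrD in f2.
rewrite /first_third /= !kh.
case: (ltP (kappa g - (Num.floor (kappa g))%:~R) (1 / 3)) => [|c1]; first by constructor 1.
case: (ltP (kappa g - (Num.floor (kappa g))%:~R) (2 / 3)) => c2.
  constructor 3; rewrite (_ : Num.floor _ = Num.floor (kappa g) + 1) ?intrD; first lra.
  by apply: floor_def; rewrite !intrD; lra.
constructor 2; rewrite (_ : Num.floor _ = Num.floor (kappa g) + 1) ?intrD; first lra.
by apply: floor_def; rewrite !intrD; lra.
Qed.

Lemma circle_fun_hdetl L a b xi : lattice_basis L a b xi ->
  circle_fun L (fun g => hdet g b / hdet a b).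
Proof.
move=> [_ d0 intL _ _]; split.
  by apply: measurable_funM => //; exact: measurable_hdetl.
move=> g lam Ll; rewrite -mulrBl hdetMl addrAC subrr add0r.
by case: (intL _ Ll).
Qed.

Lemma circle_fun_hdetr L a b xi : lattice_basis L a b xi ->
  circle_fun L (fun g => hdet a g / hdet a b).
Proof.
move=> [_ d0 intL _ _]; split.
  by apply: measurable_funM => //; exact: measurable_hdetr.
move=> g lam Ll; rewrite -mulrBl hdetMr addrAC subrr add0r.
by case: (intL _ Ll).
Qed.

(* The central coordinate of g after translating p(g) into the fundamental
   parallelogram by an element of L. *)
Lemma central_circle_fun L a b xi : subgroup L -> lattice_basis L a b xi ->
  exists2 kappa, circle_fun L kappa &
    forall t g, kappa (cen t ** g) = kappa g + t / xi.
Proof.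
move=> sL bL; have [[La Lb] d0 intL xi0 cL] := bL.
have /choice[s sP] : forall mn : int * int, exists s, L s /\
    (hdet s b / hdet a b = mn.1%:~R /\ hdet a s / hdet a b = mn.2%:~R).
  by move=> [m n]; have [s Ls [s1 s2]] := subg_coords m n sL La Lb d0; exists s.
pose fl g := (Num.floor (hdet g b / hdet a b), Num.floor (hdet a g / hdet a b)).
pose kappa g := (g ** hinv (s (fl g))).2 / xi.
exists kappa; last first.
  move=> t g; rewrite /kappa (_ : fl (cen t ** g) = fl g).
    by rewrite -hmulA /=; field; rewrite lt0r_neq0.
  have c1 : hdet (cen t) b = 0 by rewrite /hdet /=; ring.
  have c2 : hdet a (cen t) = 0 by rewrite /hdet /=; ring.
  by rewrite /fl hdetMl hdetMr c1 c2 !add0r.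
split.
- move=> _ B mB; rewrite setTI.
  pose D (mn : int * int) : set (H3 R) :=
    ((fun g => hdet g b / hdet a b) @^-1` `[mn.1%:~R, (mn.1 + 1)%:~R[%classic `&`
     (fun g => hdet a g / hdet a b) @^-1` `[mn.2%:~R, (mn.2 + 1)%:~R[%classic) `&`
    (fun g => (g ** hinv (s mn)).2 / xi) @^-1` B.
  rewrite (_ : _ @^-1` B = \bigcup_mn D mn).
    apply: countable_bigcupT_measurable => // mn.
    have mI (x y : R) : measurable (`[x, y[%classic : set R) by exact: measurable_itv.
    apply: measurableI; first apply: measurableI.
    - by apply: measurable_preim (mI _ _); case: (circle_fun_hdetl bL).
    - by apply: measurable_preim (mI _ _); case: (circle_fun_hdetr bL).
    - apply: measurable_preim mB; apply: measurable_funM => //.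
      exact: (measurableT_comp measurable_snd (measurable_hmulr _)).
  apply/seteqP; split=> [g Bg|g [mn _ [[D1 D2] D3]]].
    by exists (fl g) => //; split => //; split; rewrite /preimage /= in_itv /= floor_itv.
  rewrite /preimage /= /kappa (_ : fl g = mn) //.
  move: D1 D2; rewrite /preimage /= !in_itv /= => D1 D2.
  by rewrite /fl (floor_def D1) (floor_def D2); case: (mn).
- move=> g lam Ll; have [/intrP[m mE] /intrP[n nE]] := intL _ Ll.
  have flE : fl (g ** lam) = ((fl g).1 + m, (fl g).2 + n).
    by rewrite /fl hdetMl hdetMr (mulrDl (hdet g b)) (mulrDl (hdet a g))
      mE nE !floorDrz ?intr_int// !intrKfloor.
  pose c := s (fl g) ** lam ** hinv (s (fl (g ** lam))).
  have [Ls [s1 s2]] := sP (fl g); have [Ls' [s1' s2']] := sP (fl (g ** lam)).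
  have Lc : L c by apply: subgM => //; [exact: subgM|exact: subgV].
  have hV x : hdet a (hinv x) = - hdet a x by rewrite /hdet /=; ring.
  have cE : c = cen c.2.
    apply: (hdet0_cen d0).
      have -> : hdet c b / hdet a b = hdet (s (fl g)) b / hdet a b + hdet lam b / hdet a b -
          hdet (s (fl (g ** lam))) b / hdet a b by rewrite !hdetMl hinv_hdet; field.
      by rewrite s1 s1' mE flE /= intrD; ring.
    have -> : hdet a c / hdet a b = hdet a (s (fl g)) / hdet a b + hdet a lam / hdet a b -
        hdet a (s (fl (g ** lam))) / hdet a b by rewrite !hdetMr hV; field.
    by rewrite s2 s2' nE flE /= intrD; ring.
  have E : g ** lam ** hinv (s (fl (g ** lam))) = g ** hinv (s (fl g)) ** cen c.2.
    by rewrite -cE /c !hmulA mulhVK.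
  rewrite /kappa E (_ : _ - _ = c.2 / xi); first by apply/cL; rewrite -cE.
  by rewrite /=; field; rewrite lt0r_neq0.
Qed.

End Rotation.

Section Factor.
Variable R : realType.
Implicit Types (g h : H3 R) (U : set (H3 R)).
Variables (G L : nat -> set (H3 R)) (nG : nested_lattices G) (nL : nested_lattices L).
Variables (m : set (odo G) -> \bar R) (m' : set (odo L) -> \bar R).
Hypotheses (hm : odo_measure m) (hm' : odo_measure m').
Variable phi : odo G -> odo L.
Hypothesis mphi : forall B, odo_meas B -> odo_meas (phi @^-1` B).
Hypothesis pphi : forall B, odo_meas B -> m (phi @^-1` B) = m' B.
Hypothesis ephi : forall h, exists2 N, odo_meas N /\ m N = 0%E &
  forall x, ~ N x -> phi (odo_act h x) = odo_act h (phi x).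

Local Notation p := (odo_prob m).
Local Notation p' := (odo_prob m').

(** The element [h0] forces the preimage of the arc to have probability at least 1/3. With an error
    of 1/24 on each side, the bounds are 1/4 = 1/3 - 2/24 and 1/12 = 2/24. *)
Lemma factor_approx j kappa h0 : circle_fun (L j) kappa ->
  (forall g, kappa (h0 ** g) = kappa g + 1 / 3) ->
  exists k U, [/\ quot_borel (G k) U,
    (forall h theta (n : int), (forall g, kappa (h ** g) = kappa g + theta) ->
      1 / 3 <= theta - n%:~R <= 2 / 3 ->
      1 / 4 <= p (@cyl R G k (U `\` hmul h @^-1` U))) &
    forall h, (forall g, kappa (h ** g) = kappa g) ->
      p (@cyl R G k (U `\` hmul h @^-1` U)) <= 1 / 12].
Proof.
move=> ck h03; have qA := first_third_quot_borel ck.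
set A := first_third kappa in qA.
have mA := odo_meas_cyl qA.
pose E := phi @^-1` @cyl R L j A.
have mE : odo_meas E by exact: mphi.
have pE : 1 / 3 <= p E.
  have -> : p E = p' (@cyl R L j A) by rewrite /odo_prob pphi.
  have cov : (setT : set (odo L)) `<=` @cyl R L j A `|`
      (@odo_act R L h0 @^-1` @cyl R L j A `|`
       @odo_act R L h0 @^-1` (@odo_act R L h0 @^-1` @cyl R L j A)).
    move=> x _; rewrite !odo_act_cyl; have [g xE] := odo_coset x j.
    have sL : subgroup (L j) by apply: lattice_subgroup; case: nL.
    have qB := quot_borel_hmull h0 qA; have qC := quot_borel_hmull h0 qB.
    have cylE U : quot_borel (L j) U -> @cyl R L j U x = U g.
      by move=> [_ iU]; rewrite /cyl /= xE; apply/propext; exact: lcoset_subset.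
    rewrite /setU /= !cylE//.
    by case: (first_third_cover h03 g); [left|right; left|right; right].
  have m1 := odo_meas_act h0 mA; have m2 := odo_meas_act h0 m1.
  have := odo_prob_sub nL hm' (@odo_meas_setT R L) mA (odo_measU m1 m2) cov.
  have := odo_prob_sub nL hm' (odo_measU m1 m2) m1 m2 (@subset_refl _ _).
  rewrite odo_probT// !(odo_prob_act nL hm')//; lra.
have e0 : 0 < 1 / 24 :> R by lra.
have [k [U [qU U1 U2]]] := odo_prob_cyl_approx nG hm mE e0.
have mC := odo_meas_cyl qU.
have sG : subgroup (G k) by apply: lattice_subgroup; case: nG.
exists k, U.
have step h : let Eh := @odo_act R G h @^-1` E in
    let Ch := @odo_act R G h @^-1` @cyl R G k U in
    [/\ odo_meas Eh, odo_meas Ch, p (Eh `\` Ch) <= 1 / 24, p (Ch `\` Eh) <= 1 / 24 &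
      @cyl R G k (U `\` hmul h @^-1` U) = @cyl R G k U `\` Ch].
  split.
  - exact: odo_meas_act.
  - exact: odo_meas_act.
  - by move: U1; rewrite -(odo_prob_act nG hm h (odo_measD mE mC)).
  - by move: U2; rewrite -(odo_prob_act nG hm h (odo_measD mC mE)).
  - rewrite setDE -cylI -cylC//; last exact: quot_borel_hmull.
    by rewrite -odo_act_cyl setDE.
have memE h x N : (forall x, ~ N x -> phi (odo_act h x) = odo_act h (phi x)) ->
    ~ N x -> (@odo_act R G h @^-1` E) x = @cyl R L j (hmul h @^-1` A) (phi x).
  by move=> HN nN; rewrite /E /preimage /= HN// -odo_act_cyl.
have qUh h := quot_borel_hmull h qU.
split => //.
- move=> h theta n kh tn; have [mEh mCh Eh1 Eh2 ->] := step h.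
  have [N [mN N0] HN] := ephi h.
  have pN : p N = 0 by rewrite /odo_prob N0.
  set C := @cyl R G k U in mC U1 U2 *; set Ch := _ @^-1` C in mCh Eh1 Eh2 *.
  set Eh := _ @^-1` E in mEh Eh1 Eh2 *.
  (* The arc and its rotation are disjoint, so [E] and its translate meet only where equivariance of
     [phi] fails. *)
  have dis x : E x -> Eh x -> N x.
    move=> Ex Ehx; apply: contrapT => nN; move: Ehx; rewrite /Eh (memE _ _ _ HN nN).
    have [g xg] := odo_inhabited nL (phi x) j.
    move=> /(_ _ xg) /=; have Ag : A g by exact: Ex.
    exact: (first_third_disjoint kh tn Ag).
  have m1 : odo_meas (E `\` C) by exact: odo_measD.
  have m2 : odo_meas (Ch `\` Eh) by exact: odo_measD.
  have m3 : odo_meas (C `\` Ch) by exact: odo_measD.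
  have m12 := odo_measU m1 m2; have m3N := odo_measU m3 mN.
  have cov : E `<=` ((E `\` C) `|` (Ch `\` Eh)) `|` ((C `\` Ch) `|` N).
    move=> x Ex; have [Cx|nC] := pselect (C x); last by left; left.
    have [Chx|nCh] := pselect (Ch x); last by right; left.
    have [Ehx|nEh] := pselect (Eh x); last by left; right.
    by right; right; exact: dis.
  have := odo_prob_sub nG hm mE m12 m3N cov.
  have := odo_prob_sub nG hm m12 m1 m2 (@subset_refl _ _).
  have := odo_prob_sub nG hm m3N m3 mN (@subset_refl _ _).
  rewrite pN; lra.
- move=> h kh; have [mEh mCh Eh1 Eh2 ->] := step h.
  have [N [mN N0] HN] := ephi h.
  have pN : p N = 0 by rewrite /odo_prob N0.
  set C := @cyl R G k U in mC U1 U2 *; set Ch := _ @^-1` C in mCh Eh1 Eh2 *.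
  set Eh := _ @^-1` E in mEh Eh1 Eh2 *.
  have same x : E x -> ~ Eh x -> N x.
    move=> Ex nEh; apply: contrapT => nN; apply: nEh; rewrite /Eh (memE _ _ _ HN nN).
    by move=> g /Ex; rewrite /A /first_third /preimage /= kh.
  have m1 : odo_meas (C `\` E) by exact: odo_measD.
  have m2 : odo_meas (Eh `\` Ch) by exact: odo_measD.
  have m2N := odo_measU m2 mN.
  have m3 : odo_meas (C `\` Ch) by exact: odo_measD.
  have cov : C `\` Ch `<=` (C `\` E) `|` ((Eh `\` Ch) `|` N).
    move=> x [Cx nCh]; have [Ex|nE] := pselect (E x); last by left.
    have [Ehx|nEh] := pselect (Eh x); first by right; left.
    by right; right; exact: same.
  have := odo_prob_sub nG hm m3 m1 m2N cov.
  have := odo_prob_sub nG hm m2N m2 mN (@subset_refl _ _).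
  rewrite pN; lra.
Qed.

Lemma factor_cen_sub j : exists k, cen_sub (G k) (L j).
Proof.
have lL : lattice (L j) by case: nL.
have sL := lattice_subgroup lL.
have [a [b [xi bL]]] := lattice_has_basis lL.
have [_ _ _ xi0 cL] := bL.
have [kappa ck kc] := central_circle_fun sL bL.
have h0P g : kappa (cen (xi / 3) ** g) = kappa g + 1 / 3.
  by rewrite kc; congr (_ + _); field; rewrite lt0r_neq0.
have [k [U [qU U1 _]]] := factor_approx ck h0P.
exists k => t Gt; apply/cL; apply/negPn/negP => tN.
have [n [n' tn]] := multiple_in_middle_third tN.
have sG : subgroup (G k) by apply: lattice_subgroup; case: nG.
have Gnt : G k (cen (n%:~R * t)).
  have [lGk _] := nG; have [a' [b' [xi' [_ _ _ _ cG]]]] := lattice_has_basis (lGk k).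
  by apply/cG; rewrite -mulrA; apply: rpredM; [exact: intr_int|exact/cG].
have := U1 (cen (n%:~R * t)) (n%:~R * (t / xi)) n'.
(* Left translation by a central element is right translation, under which [U] is invariant. *)
rewrite (_ : U `\` _ = set0); last first.
  rewrite -subset0 => g [Ug]; apply; rewrite /= cenC.
  by case: qU => _; apply.
rewrite (_ : @cyl R G k set0 = set0); last first.
  rewrite -subset0 => x; have [g xg] := odo_inhabited nG x k.
  by move=> /(_ _ xg).
rewrite (odo_prob0 hm); have kh g : kappa (cen (n%:~R * t) ** g) = kappa g + n%:~R * (t / xi).
  by rewrite kc mulrA.
by move=> /(_ kh tn); lra.
Qed.

End Factor.

(** By Tonelli, [S] and [S'] have the same mass since their sections over [T1] do; slicing over [T2]
    instead bounds this mass below through [S] and above through [S']. *)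
Lemma le_section_average d1 d2 (T1 : measurableType d1) (T2 : measurableType d2)
    (R : realType) (m1 : {sigma_finite_measure set T1 -> \bar R})
    (m2 : {sigma_finite_measure set T2 -> \bar R}) (S S' : set (T1 * T2))
    (I : set T2) (c1 c2 : R) :
  measurable S -> measurable S' -> measurable I -> 0 <= c1 -> 0 <= c2 ->
  (forall x, m2 (xsection S x) = m2 (xsection S' x)) ->
  (forall y, I y -> c1%:E <= m1 (ysection S y))%E ->
  (forall y, I y -> m1 (ysection S' y) <= c2%:E)%E ->
  (forall y, ~ I y -> ysection S' y = set0) ->
  (c1%:E * m2 I <= c2%:E * m2 I)%E.
Proof.
move=> mS mS' mI c10 c20 xSS' lo up out.
have sections X : measurable X ->
    (\int[m1]_x m2 (xsection X x) = \int[m2]_y m1 (ysection X y))%E.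
  move=> mX; apply: (@product_measure_unique _ _ _ _ _ m1 m2 (m1 \x^ m2)%E) => //.
  by move=> A B mA mB; exact: product_measure2E.
have intc (c : R) : 0 <= c -> (\int[m2]_y (c * \1_I y)%:E = c%:E * m2 I)%E.
  move=> c0; rewrite (eq_integral (fun y => c%:E * (\1_I y)%:E)%E)//.
  rewrite ge0_integralZl_EFin//; last exact/measurable_EFinP/measurable_indic.
  by rewrite integral_indic// setIT.
have mind (c : R) : measurable_fun setT (fun y => (c * \1_I y)%:E).
  by apply/measurable_EFinP; apply: measurable_funM => //; exact: measurable_indic.
rewrite -!intc//.
apply: (@le_trans _ _ (\int[m2]_y m1 (ysection S y))%E).
  apply: ge0_le_integral => //.
  - by move=> y _; rewrite lee_fin mulr_ge0.
  - exact: measurable_fun_ysection.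
  - move=> y _; rewrite indicE; case: (boolP (y \in I)) => Iy.
      by rewrite mulr1 lo//; exact/set_mem.
    by rewrite mulr0.
rewrite -sections// (eq_integral (fun x => m2 (xsection S' x))); last by move=> x _.
rewrite sections//; apply: ge0_le_integral => //.
- exact: measurable_fun_ysection.
- move=> y _; rewrite indicE; case: (boolP (y \in I)) => Iy.
    by rewrite mulr1 up//; exact/set_mem.
  by rewrite mulr0 out ?measure0// => /mem_set; rewrite (negPf Iy).
Qed.

(** * Averages over a period of the centre *)

Section CentralAverage.
Variable R : realType.
Implicit Types (g h w : H3 R) (G U F : set (H3 R)) (W : set R).
Local Notation mu := (@mu R).
Local Notation leb := (@leb R).

Lemma leb_invariant_shift W (a b c : R) : measurable W ->
  (forall s, W (s + c) <-> W s) ->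
  leb (W `&` `[a + c, b + c[%classic) = leb (W `&` `[a, b[%classic).
Proof.
move=> mW Wc; rewrite -(leb_translation c); last first.
  by apply: measurableI => //; exact: measurable_itv.
congr leb; apply/seteqP; split=> s [] /=; rewrite !in_itv /= lerD2r ltrD2r.
  by move=> /Wc.
by move=> /Wc.
Qed.

(** The window is first brought to start at a point [b] of [0, xi]; the part of it beyond [xi] is
    then the shift of [0, b[. *)
Lemma leb_periodic W (xi a : R) : 0 < xi -> measurable W ->
  (forall s, W (s + xi) <-> W s) ->
  leb (W `&` `[a, a + xi[%classic) = leb (W `&` `[0, xi[%classic).
Proof.
move=> xi0 mW Wxi.
have mWI (x y : R) : measurable (W `&` `[x, y[%classic).
  by apply: measurableI => //; exact: measurable_itv.
have Wz (n : int) s : W (s + n%:~R * xi) <-> W s.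
  elim: n => [|n IH|n IH] in s *; first by rewrite mul0r addr0.
  - by rewrite intz_succ mulrDl mul1r addrA Wxi IH.
  - have e : s + (- Posz n.+1)%:~R * xi + xi = s + (- Posz n)%:~R * xi.
      by rewrite !intrN intz_succ; ring.
    by rewrite -(IH s) -e; split=> /Wxi.
have split3 (x y z : R) : x <= y -> y <= z -> leb (W `&` `[x, z[%classic) =
    (leb (W `&` `[x, y[%classic) + leb (W `&` `[y, z[%classic))%E.
  move=> xy yz; rewrite -measureU//.
    congr leb; rewrite -setIUr; congr (W `&` _).
    apply/seteqP; split=> s /=; rewrite !in_itv /=.
      by move=> /andP[s1 s2]; case: (ltP s y) => sy; [left; rewrite s1|right; rewrite s2].
    by case=> /andP[s1 s2]; apply/andP; split; lra.
  rewrite -subset0 => s [[_ +] [_]] /=; rewrite !in_itv /= => /andP[_ s1] /andP[s2 _].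
  by have := lt_le_trans s1 s2; rewrite ltxx.
pose n := Num.floor (a / xi); pose b := a - n%:~R * xi.
have := floor_itv (a / xi); rewrite intrD ler_pdivlMr// ltr_pdivrMr// mulrDl mul1r.
rewrite -/n => /andP[n1 n2].
have b0 : 0 <= b by rewrite /b; lra.
have bxi : b <= xi by rewrite /b; lra.
have -> : leb (W `&` `[a, a + xi[%classic) = leb (W `&` `[b, b + xi[%classic).
  rewrite -(leb_invariant_shift b (b + xi) mW (Wz n)).
  have e1 : b + n%:~R * xi = a by rewrite /b subrK.
  by rewrite (addrAC b) e1.
rewrite (split3 b xi); [|by []|lra].
rewrite (split3 0 b)// addeC; congr (_ + _)%E.
by rewrite -{1}(add0r xi) (leb_invariant_shift 0 b mW Wxi).
Qed.

(* The left translate of U by an element w of G and the translates of U by the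
   centre have the same average, since w ** g and the central translate of g by
   hdet w g lie in the same coset of G. *)
Lemma central_average G U F (xi c1 c2 : R) w : subgroup G -> G (cen xi) -> 0 < xi ->
  measurable F -> quot_borel G U -> G w -> 0 <= c1 -> 0 <= c2 ->
  (forall t, (c1%:E <= mu ((U `\` hmul (cen t ** w) @^-1` U) `&` F))%E) ->
  (forall t, (mu ((U `\` hmul (cen t) @^-1` U) `&` F) <= c2%:E)%E) -> c1 <= c2.
Proof.
move=> sG Gxi xi0 mF [mU iU] Gw c10 c20 lo up.
pose I : set R := `[0, xi[%classic.
have mI : measurable I by exact: measurable_itv.
pose f v (p : H3 R * R) := cen p.2 ** v ** p.1.
have mf v : measurable_fun setT (f v).
  rewrite (_ : f v = fun p => ((v ** p.1).1, (v ** p.1).2 + p.2)).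
    have m1 : measurable_fun setT (fun p : H3 R * R => v ** p.1).
      exact: (measurableT_comp (measurable_hmull v) measurable_fst).
    apply: measurable_fun_pair; first exact: (measurableT_comp measurable_fst m1).
    by apply: measurable_funD => //; exact: (measurableT_comp measurable_snd m1).
  apply/funext => -[[[x y] z] t]; rewrite /f /hmul /cen /=.
  by congr (_, _, _); ring.
(* The section of [S v] at [t] is what [U] loses inside [F] under translation by [cen t ** v]; [w]
   and the identity are compared through the sections at [g]. *)
pose S v : set (H3 R * R) := ((U `&` F) `*` I) `\` (f v @^-1` U).
have mS v : measurable (S v).
  apply: measurableD; last exact: (measurable_preim (mf v) mU).
  by apply: measurableX => //; exact: measurableI.
have UG g v : G v -> U (g ** v) = U g.
  move=> Gv; apply/propext; split; last by move=> /iU; apply.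
  by move=> /iU /(_ (subgV sG Gv)); rewrite mulhK.
have xS v g : G v -> leb (xsection (S v) g) = leb (xsection (S (hone R)) g).
  move=> Gv; have [UFg|nUFg] := pselect ((U `&` F) g); last first.
    by congr leb; apply/seteqP; split=> t; rewrite /xsection /= !inE => -[[]].
  pose W : set R := [set s | ~ U (cen s ** g)].
  have mW : measurable W.
    apply: measurableC; have mc : measurable_fun setT (fun s : R => cen s ** g).
      rewrite (_ : (fun _ => _) = fun s : R => f (hone R) (g, s)).
        exact: (measurableT_comp (mf _) (measurable_pair1 g)).
      by apply/funext => s; rewrite /f mulh1.
    exact: (measurable_preim mc mU).
  have Wxi s : W (s + xi) <-> W s.
    rewrite /W /= cenD -hmulA [cen xi ** g]cenC hmulA.
    by rewrite UG.
  (* Commuting [v'] past [g] only shifts the time by [hdet v' g]. The section is thus a window of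
     one full period of [W], whose measure does not depend on [v']. *)
  have xE v' : G v' -> xsection (S v') g =
      (fun t => t + hdet v' g) @^-1` (W `&` `[hdet v' g, hdet v' g + xi[%classic).
    move=> Gv'; apply/seteqP; split => t; rewrite /xsection /= inE /S /setD /= /f /=.
      move=> [[_ It] nU]; split; last by move: It; rewrite /I /= !in_itv /=; lra.
      move=> Ut; apply: nU; rewrite -hmulA (commE v' g) !hmulA -cenD.
      by rewrite UG.
    move=> [nU It]; split; first by split => //; move: It; rewrite /I /= !in_itv /=; lra.
    by rewrite -hmulA (commE v' g) !hmulA -cenD UG.
  have mWI (x y : R) : measurable (W `&` `[x, y[%classic).
    by apply: measurableI => //; exact: measurable_itv.
  rewrite !xE//; last exact: subg1.
  by rewrite !leb_translation// !leb_periodic.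
have yS v t : I t -> mu (ysection (S v) t) = mu ((U `\` hmul (cen t ** v) @^-1` U) `&` F).
  move=> It; congr mu; apply/seteqP; split=> g; rewrite /ysection /= inE /S /setD /= /f /=.
    by move=> [[[Ug Fg] _] nU].
  by move=> [[Ug nU] Fg].
have LI : leb I = xi%:E := leb_itv0 (ltW xi0).
suff : (c1%:E * leb I <= c2%:E * leb I)%E by rewrite LI -!EFinM lee_fin ler_pM2r.
apply: (@le_section_average _ _ (H3 R) R R mu leb (S w) (S (hone R)) I c1 c2) => //.
- by move=> g; exact: xS.
- by move=> t It; have := lo t; rewrite -(yS w t It).
- by move=> t It; have := up t; rewrite -{1}(mulh1 (cen t)) -(yS (hone R) t It).
- move=> t nIt; rewrite -subset0 => g.
  by rewrite /ysection /= inE => -[[_ It] _].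
Qed.

End CentralAverage.

(** * Invariants under factor maps and isomorphisms *)

Section Isomorphism.
Variable R : realType.
Implicit Types (g h : H3 R) (U : set (H3 R)).
Local Notation mu := (@mu R).

Definition factor_map (G L : nat -> set (H3 R)) (m : set (odo G) -> \bar R)
    (m' : set (odo L) -> \bar R) (phi : odo G -> odo L) : Prop :=
  [/\ forall B, odo_meas B -> odo_meas (phi @^-1` B),
      forall B, odo_meas B -> m (phi @^-1` B) = m' B &
      forall h, exists2 N, odo_meas N /\ m N = 0%E &
        forall x, ~ N x -> phi (odo_act h x) = odo_act h (phi x)].

Lemma pairingM v g h : pairing v (g ** h) = pairing v g + pairing v h.
Proof. by rewrite /pairing /=; ring. Qed.

Lemma measurable_pairing (v : 'cV[R]_2) : measurable_fun setT (pairing v).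
Proof.
rewrite /pairing; apply: measurable_funD; apply: measurable_funM => //.
  exact: (measurableT_comp measurable_fst measurable_fst).
exact: (measurableT_comp measurable_snd measurable_fst).
Qed.

Section FactorMap.
Variables (G L : nat -> set (H3 R)) (nG : nested_lattices G) (nL : nested_lattices L).
Variables (m : set (odo G) -> \bar R) (m' : set (odo L) -> \bar R).
Hypotheses (hm : odo_measure m) (hm' : odo_measure m').
Variable phi : odo G -> odo L.
Hypothesis fphi : factor_map m m' phi.

Lemma factor_xi_of : xi_of L `<=` xi_of G.
Proof.
have [mphi pphi ephi] := fphi.
by apply: xi_of_mono => // j; exact: (factor_cen_sub nG nL hm hm' mphi pphi ephi).
Qed.

Lemma factor_S_of : S_of L `<=` S_of G.
Proof.
move=> v /(S_ofP _ nL)[j vL]; apply/S_ofP => //.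
have [mphi pphi ephi] := fphi.
(* Without such an [h0] the pairing vanishes identically, since a nonzero value could be rescaled to
   1/3, and any level will do. *)
have [[h0 vh0]|v0] := pselect (exists h0, pairing v h0 = 1 / 3); last first.
  exists 0 => g _; have [->|vg] := eqVneq (pairing v g) 0; first exact: int_num0.
  exfalso; apply: v0; pose c := 1 / 3 / pairing v g.
  exists (c * g.1.1, c * g.1.2, 0); rewrite /pairing /=.
  rewrite (_ : _ + _ = c * pairing v g); last by rewrite /pairing; ring.
  by rewrite divfK.
have ck : circle_fun (L j) (pairing v).
  split; first exact: measurable_pairing.
  by move=> g lam Ll; rewrite pairingM addrAC subrr add0r; exact: vL.
have h03 g : pairing v (h0 ** g) = pairing v g + 1 / 3.
  by rewrite pairingM vh0 addrC.
have [k [U [qU U1 U2]]] := factor_approx nG nL hm hm' mphi pphi ephi ck h03.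
exists k => g Gg; apply/negPn/negP => vN.
have [n [n' nv]] := multiple_in_middle_third vN.
have lG : lattice (G k) by case: nG.
have sG := lattice_subgroup lG.
have [w Gw [w1 w2]] := subg_mulz sG n Gg.
have pw : pairing v w = n%:~R * pairing v g by rewrite /pairing w1 w2; ring.
have [a [b [xi [_ _ _ xi0 cG]]]] := lattice_has_basis lG.
have [dG [F fF]] := lG; rewrite -/(mu F) => Ffin.
have FE : mu F = (fine (mu F))%:E by rewrite fineK// ge0_fin_numE.
have := mu_fundamental_domain_gt0 dG fF; rewrite FE lte_fin.
set f := fine (mu F) in FE * => f0.
have pcen t : pairing v (cen t) = 0 by rewrite /pairing /=; ring.
have qV h : quot_borel (G k) (U `\` hmul h @^-1` U).
  rewrite setDE; apply: quot_borelI => //; apply: quot_borelC => //.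
  exact: quot_borel_hmull.
have muV h : mu ((U `\` hmul h @^-1` U) `&` F) =
    (odo_prob m (@cyl R G k (U `\` hmul h @^-1` U)) * f)%:E.
  by rewrite -(odo_prob_cyl nG hm (qV h) fF Ffin) FE EFinM.
(* The factor [f] converts probabilities at level [k] into Haar measure inside [F]. As [v] ignores
   the centre, [cen t ** w] rotates by the same angle as [w], so both bounds of [factor_approx] hold
   for all [t]. *)
have : 1 / 4 * f <= 1 / 12 * f; last by lra.
apply: (@central_average R (G k) U F xi _ _ w sG) => //.
- by apply/cG; rewrite divff ?lt0r_neq0// int_num1.
- by case: fF.
- by apply: mulr_ge0; lra.
- by apply: mulr_ge0; lra.
- move=> t; rewrite muV lee_fin ler_pM2r//; apply: (U1 _ (n%:~R * pairing v g) n') => //.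
  by move=> x; rewrite !pairingM pcen pw add0r addrC.
- move=> t; rewrite muV lee_fin ler_pM2r//; apply: U2 => x.
  by rewrite pairingM pcen add0r.
Qed.

End FactorMap.

(** Outside null sets, [psi (h y) = psi (h (phi (psi y))) = psi (phi (h (psi y))) = h (psi y)]. The
    exceptional sets live partly on [odo G], and [psi] pulls null sets back to null sets because it
    preserves measure. *)
Lemma isomorphism_inverse_factor (G L : nat -> set (H3 R))
    (m : set (odo G) -> \bar R) (m' : set (odo L) -> \bar R) phi psi :
  nested_lattices G -> nested_lattices L -> odo_measure m -> odo_measure m' ->
  odo_isomorphism m m' phi psi -> factor_map m' m psi.
Proof.
move=> nG nL hm hm' [mphi mpsi pphi [[N [mN N0] psiphi] [N' [mN' N'0] phipsi] ephi]].
have pN : odo_prob m N = 0 by rewrite /odo_prob N0.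
have pN' : odo_prob m' N' = 0 by rewrite /odo_prob N'0.
have prob_psi A : odo_meas A -> odo_prob m' (psi @^-1` A) = odo_prob m A.
  move=> mA; have mpA := mpsi _ mA; have mppA := mphi _ mpA.
  have -> : odo_prob m' (psi @^-1` A) = odo_prob m (phi @^-1` (psi @^-1` A)).
    by rewrite /odo_prob pphi.
  apply/eqP; rewrite eq_le; apply/andP; split.
  - rewrite -[leRHS]addr0 -pN; apply: (odo_prob_sub nG hm) => // x /= Ax.
    by have [Nx|nNx] := pselect (N x); [right|left; rewrite -(psiphi _ nNx)].
  - rewrite -[leRHS]addr0 -pN; apply: (odo_prob_sub nG hm) => // x Ax.
    have [Nx|nNx] := pselect (N x); [by right|left].
    by rewrite /preimage /= (psiphi _ nNx).
split=> //.
- by move=> A mA; rewrite (odo_probE nL hm' (mpsi _ mA)) (odo_probE nG hm mA) prob_psi.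
- move=> h; have [Nh [mNh Nh0] HNh] := ephi h.
  have pNh : odo_prob m Nh = 0 by rewrite /odo_prob Nh0.
  have mhN := odo_meas_act h mN.
  have m1 := mpsi _ mNh; have m2 := mpsi _ mhN.
  have m12 := odo_measU m1 m2; have mB := odo_measU mN' m12.
  exists (N' `|` (psi @^-1` Nh `|` psi @^-1` (@odo_act R G h @^-1` N))).
    split=> //; rewrite (odo_probE nL hm' mB); congr EFin; apply/eqP; rewrite eq_le.
    apply/andP; split; last by rewrite /odo_prob fine_ge0//; case: hm' => _ + _ _; exact.
    have := odo_prob_sub nL hm' mB mN' m12 (@subset_refl _ _).
    have := odo_prob_sub nL hm' m12 m1 m2 (@subset_refl _ _).
    rewrite !prob_psi// (odo_prob_act nG hm)// pN pN' pNh; lra.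
  move=> y nB.
  have nN' : ~ N' y by move=> ?; apply: nB; left.
  have nNh : ~ Nh (psi y) by move=> ?; apply: nB; right; left.
  have nN : ~ N (odo_act h (psi y)) by move=> ?; apply: nB; right; right.
  by rewrite -{1}(phipsi _ nN') -HNh// psiphi.
Qed.

Lemma odo_iso_invariants (G L : nat -> set (H3 R)) :
  nested_lattices G -> nested_lattices L -> odo_iso G L ->
  S_of G = S_of L /\ xi_of G = xi_of L.
Proof.
move=> nG nL [m [m' [hm hm' [phi [psi iso]]]]].
have fpsi := isomorphism_inverse_factor nG nL hm hm' iso.
have [mphi _ pphi [_ _ ephi]] := iso.
have fphi : factor_map m m' phi by split.
split; apply/seteqP; split.
- exact: (factor_S_of nL nG hm' hm fpsi).
- exact: (factor_S_of nG nL hm hm' fphi).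
- exact: (factor_xi_of nL nG hm' hm fpsi).
- exact: (factor_xi_of nG nL hm hm' fphi).
Qed.

Lemma conjugate_invariants (L L' : nat -> set (H3 R)) :
  nested_lattices L -> nested_lattices L' -> (forall j, conjugate (L j) (L' j)) ->
  S_of L = S_of L' /\ xi_of L = xi_of L'.
Proof.
move=> nL nL' conjLL'; have [lL _] := nL.
have H j := conjugate_sub (lL j) (conjLL' j).
split; apply/seteqP; split.
- by apply: S_of_mono => // j; exists j; have [_ []] := H j.
- by apply: S_of_mono => // j; exists j; have [] := H j.
- by apply: xi_of_mono => // j; exists j; have [_ [_ []]] := H j.
- by apply: xi_of_mono => // j; exists j; have [_ [_ []]] := H j.
Qed.

End Isomorphism.

Theorem theorem5p7 (R : realType) (G G' : nat -> set (H3 R)) :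
  nested_lattices G -> nested_lattices G' ->
  (f_isomorphic G G' <-> S_of G = S_of G' /\ xi_of G = xi_of G').
Proof.
move=> nG nG'; split; last by case; exact: f_isomorphic_of_invariants.
move=> [L [L' [nL nL' conjLL' isoGL isoGL']]].
have [-> ->] := odo_iso_invariants nG nL isoGL.
have [-> ->] := odo_iso_invariants nG' nL' isoGL'.
exact: conjugate_invariants.
Qed.
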